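(* We have \[ \Phi_{x,y}^{\text{ш}}(T;X_1,X_2,\dots)=\rho_{x,y}(\Phi_{x,y}^{*}(T;X_1,X_2,\dots)). \]
   Context: An index is a finite (possibly empty) sequence of positive integers; $I$ is the set of indices. For $\bullet\in\{*,\text{ш}\}$ ($*$ the harmonic/stuffle product, $\text{ш}$ the shuffle product), $\zeta^{\bullet}(\mathbf{k};T)\in\mathbb{R}[T]$ is the Ihara–Kaneko–Zagier regularization of multiple zeta values. For $\mathbf{k}=(k_1,\dots,k_r)\in I$, $\zeta_{x,y}^{\bullet}(\mathbf{k};T)=\sum_{i=0}^{r}x^{k_1+\dots+k_i}y^{k_{i+1}+\dots+k_r}\zeta^{\bullet}(k_i,\dots,k_1;T)\zeta^{\bullet}(k_{i+1},\dots,k_r;T)$ (with value $1$ at the empty index). Put $w(\mathbf{k};X_1,X_2,\dots)=X_{k_1}\dotsm X_{k_r}$ (noncommuting variables) and $\Phi_{x,y}^{\bullet}(T;X_1,X_2,\dots)=\sum_{\mathbf{k}\in I}\zeta_{x,y}^{\bullet}(\mathbf{k};T)w(\mathbf{k};X_1,X_2,\dots)$. Let $A_{x,y}(u)=\exp\bigl(\sum_{n=2}^{\infty}\frac{(-1)^n}{n}\zeta(n)\frac{x^n+y^n}{(x+y)^n}u^n\bigr)$ and let $\rho_{x,y}$ be the $\mathbb{R}(x,y)$-linear map on $\mathbb{R}(x,y)[T]$ with $\rho_{x,y}(e^{Tu})=A_{x,y}(u)e^{Tu}$, extended coefficientwise to formal power series in $X_1,X_2,\dots$. *)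

(* Defs.v *)
From HB Require Import structures.
From mathcomp Require Import all_boot all_order all_algebra.
From mathcomp Require Import all_classical all_reals all_analysis.

Set Implicit Arguments.
Unset Strict Implicit.
Unset Printing Implicit Defensive.

Import Order.TTheory GRing.Theory Num.Theory numFieldNormedType.Exports.
Local Open Scope classical_set_scope.
Local Open Scope ring_scope.

(** * Indices *)

Definition posnat := {n : nat | (0 < n)%N}.
Definition posnat_succ (n : nat) : posnat := exist _ n.+1 isT.
Definition posnat_add (a b : posnat) : posnat :=
  exist _ (val a + val b)%N (ltn_addr (val b) (valP a)).

Definition mzindex := seq posnat.

Definition weight (k : mzindex) : nat := (\sum_(a <- k) val a)%N.

(** An index is admissible when it is empty or its first entry is at least 2:
    this is the convergence condition for the summation order
    [m_1 > ... > m_r > 0] of Ihara, Kaneko and Zagier. *)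
Definition admissible (k : mzindex) : bool :=
  if k is a :: _ then (1 < val a)%N else true.

(** * Harmonic and shuffle products *)

(** The product of two basis elements of the algebra of indices is a formal sum
    of basis elements, given here as the list of its terms with multiplicity. *)
Fixpoint stuffle (k : mzindex) : mzindex -> seq mzindex :=
  if k is a :: k' then
    fix stuffle_k (l : mzindex) :=
      if l is b :: l' then
        [seq a :: m | m <- stuffle k' l] ++
        [seq b :: m | m <- stuffle_k l'] ++
        [seq posnat_add a b :: m | m <- stuffle k' l']
      else [:: k]
  else fun l => [:: l].

Fixpoint shuffle (T : Type) (u : seq T) : seq T -> seq (seq T) :=
  if u is a :: u' then
    fix shuffle_u (v : seq T) :=
      if v is b :: v' then
        [seq a :: m | m <- shuffle u' v] ++ [seq b :: m | m <- shuffle_u v']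
      else [:: u]
  else fun v => [:: v].

(** Words in the letters [x] (encoded by [false]) and [y] (encoded by [true]):
    the index [k_1, ..., k_r] is the word [x^(k_1-1) y ... x^(k_r-1) y]. *)
Definition word_of_index (k : mzindex) : seq bool :=
  flatten [seq rcons (nseq (val a).-1 false) true | a <- k].

(** Left inverse of [word_of_index]; only meaningful on words that are empty
    or end in [y].  The accumulator [n] counts the pending letters [x]. *)
Fixpoint index_of_word_from (n : nat) (u : seq bool) : mzindex :=
  match u with
  | [::] => [::]
  | false :: u' => index_of_word_from n.+1 u'
  | true :: u' => posnat_succ n :: index_of_word_from 0 u'
  end.
Definition index_of_word := index_of_word_from 0.

Lemma word_of_indexK : cancel word_of_index index_of_word.
Proof.
elim=> [//|[a a_gt0] k IHk].
rewrite /word_of_index /= cat_rcons -/(word_of_index k) /index_of_word.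
suff H n u c : index_of_word_from c (nseq n false ++ true :: u) =
    posnat_succ (c + n) :: index_of_word u.
  by rewrite H IHk; congr (_ :: _); apply: val_inj; rewrite /= add0n prednK.
by elim: n c => [|n IHn] c /=; rewrite ?addn0 // IHn addSnnS.
Qed.

Definition index_shuffle (k l : mzindex) : seq mzindex :=
  [seq index_of_word u | u <- shuffle (word_of_index k) (word_of_index l)].

Inductive product := Harmonic | Shuffle.

Definition index_product (b : product) : mzindex -> mzindex -> seq mzindex :=
  match b with Harmonic => stuffle | Shuffle => index_shuffle end.

(** * Multiple zeta values and their regularizations *)

(** The sum of [m_1^(-k_1) ... m_r^(-k_r)] over [N > m_1 > ... > m_r > 0]. *)
Fixpoint mzv_trunc (R : realType) (k : mzindex) (N : nat) : R :=
  if k is a :: k' then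
    \sum_(1 <= m < N) (m%:R ^+ val a)^-1 * mzv_trunc R k' m
  else 1.

Definition mzv (R : realType) (k : mzindex) : R :=
  lim (mzv_trunc R k N @[N --> \oo]).

(** [Z] is, on the basis of indices, the homomorphism to [R[T]] from the algebra
    of all indices with the product [b], extending the multiple zeta values of
    admissible indices and sending the index [(1)] to [T]. *)
Definition is_regularization (R : realType) (b : product)
    (Z : mzindex -> {poly R}) : Prop :=
  [/\ forall k, admissible k -> Z k = (mzv R k)%:P,
      Z [:: posnat_succ 0] = 'X
    & forall k l, Z k * Z l = \sum_(m <- index_product b k l) Z m].

(** By Ihara, Kaneko and Zagier there is exactly one such homomorphism, so the
    default value [fun=> 0] is irrelevant. *)
Definition zeta_reg (R : realType) (b : product) : mzindex -> {poly R} :=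
  xget (fun=> 0) [set Z | is_regularization b Z].

(** * The field [R(x,y)] and the polynomials [zeta_{x,y}(k;T)] *)

Definition ratxy (R : realType) : fieldType := {fraction {poly {poly R}}}.

Definition ratxyC (R : realType) (c : R) : ratxy R := tofrac (c%:P%:P).
Definition ratx (R : realType) : ratxy R := tofrac ('X%:P).
Definition raty (R : realType) : ratxy R := tofrac 'X.

Definition zeta_regxy (R : realType) (b : product) (k : mzindex)
    : {poly ratxy R} :=
  map_poly (@ratxyC R) (zeta_reg R b k).

Definition zeta_xy (R : realType) (b : product) (k : mzindex)
    : {poly ratxy R} :=
  \sum_(i < (size k).+1)
    (ratx R ^+ weight (take i k) * raty R ^+ weight (drop i k)) *:
      (zeta_regxy R b (rev (take i k)) * zeta_regxy R b (drop i k)).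

(** * Formal power series in the noncommuting variables [X_1, X_2, ...] *)

(** A series is the function sending each word [X_{k_1} ... X_{k_r}], written
    as the list of its subscripts, to its coefficient. *)
Definition ncseries (A : Type) := seq posnat -> A.

Section NcSeries.
Variable A : pzRingType.

Definition ncs1 : ncseries A := fun v => (v == [::])%:R.
Definition ncsX (a : posnat) : ncseries A := fun v => (v == [:: a])%:R.
Definition ncs_mul (f g : ncseries A) : ncseries A :=
  fun v => \sum_(i < (size v).+1) f (take i v) * g (drop i v).

Definition ncs_w (k : mzindex) : ncseries A :=
  foldr (fun a f => ncs_mul (ncsX a) f) ncs1 k.

End NcSeries.

(** The sum over all indices is taken coefficientwise, where it has finite
    support: only [k = v] contributes to the coefficient of the word [v]. *)
Definition Phi (R : realType) (b : product) : ncseries {poly ratxy R} :=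
  fun v =>
    \sum_(k \in [set: mzindex]) zeta_xy R b k * ncs_w {poly ratxy R} k v.

Lemma ncs_wE (A : pzRingType) (k : mzindex) (v : seq posnat) :
  ncs_w A k v = (v == k)%:R.
Proof.
elim: k v => [//|a k IHk] v; rewrite /= /ncs_mul.
case: v => [|b v].
  by rewrite big_ord_recl big_ord0 /= /ncsX mul0r addr0.
rewrite big_ord_recl /= {1}/ncsX mul0r add0r big_ord_recl /= take0 drop0 IHk.
rewrite big1 ?addr0 => [|i _].
  by rewrite /ncsX !eqseq_cons andbT -natrM mulnb.
rewrite /ncsX -[X in X * _]/((_ == _)%:R) /= eqseq_cons.
have -> : (take i.+1 v == [::]) = false; last by rewrite andbF mul0r.
by case: v i => [[]//|].
Qed.

Lemma PhiE (R : realType) (b : product) (k : mzindex) :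
  Phi R b k = zeta_xy R b k.
Proof.
rewrite /Phi -(fsbig_widen [set k]) //; last first.
  by move=> l [_ /= /eqP lk]; rewrite ncs_wE eq_sym (negbTE lk) mulr0.
by rewrite fsbig_set1 ncs_wE eqxx mulr1.
Qed.

(** * Formal power series in [u], as sequences of coefficients *)

Section PowerSeries.
Variable A : comPzRingType.

Definition ps1 : nat -> A := fun n => (n == 0%N)%:R.
Definition ps_mul (f g : nat -> A) : nat -> A :=
  fun n => \sum_(i < n.+1) f i * g (n - i)%N.
Definition ps_pow (f : nat -> A) (j : nat) : nat -> A := iter j (ps_mul f) ps1.

End PowerSeries.

(** The exponential of a series without constant term: [f^j] does not
    contribute to the coefficient of [u^n] when [j > n]. *)
Definition ps_exp (F : fieldType) (f : nat -> F) : nat -> F :=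
  fun n => \sum_(j < n.+1) (j`!%:R)^-1 * ps_pow f j n.

(** * The map [rho_{x,y}] *)

Definition Axy (R : realType) : nat -> ratxy R :=
  ps_exp (fun n => if (n < 2)%N then 0 else
    (-1) ^+ n / n%:R * ratxyC (mzv R [:: posnat_succ n.-1]) *
    ((ratx R ^+ n + raty R ^+ n) / (ratx R + raty R) ^+ n)).

Definition expTu (R : realType) : nat -> {poly ratxy R} :=
  fun m => (m`!%:R)^-1 *: 'X^m.

Definition AexpTu (R : realType) : nat -> {poly ratxy R} :=
  ps_mul (fun n => (Axy R n)%:P) (expTu R).

(** The linear map whose value at [T^m / m!], the coefficient of [u^m] in
    [e^{Tu}], is the coefficient of [u^m] in [A_{x,y}(u) e^{Tu}]. *)
Definition rho (R : realType) (p : {poly ratxy R}) : {poly ratxy R} :=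
  \sum_(m < size p) (p`_m * m`!%:R) *: AexpTu R m.

Lemma rho_widen (R : realType) (p : {poly ratxy R}) (n : nat) :
  (size p <= n)%N -> rho p = \sum_(m < n) (p`_m * m`!%:R) *: AexpTu R m.
Proof.
move=> le_pn; rewrite /rho.
rewrite (big_ord_widen n (fun m => (p`_m * m`!%:R) *: AexpTu R m) le_pn).
rewrite [RHS](bigID (fun i : 'I_n => (i < size p)%N)) /=.
rewrite [X in _ = _ + X]big1 ?addr0 // => i; rewrite -leqNgt => le_pi.
by rewrite nth_default // mul0r scale0r.
Qed.

Lemma rho_linear (R : realType) : linear (@rho R).
Proof.
move=> c p q; pose n := maxn (size (c *: p + q)) (maxn (size p) (size q)).
rewrite !(@rho_widen R _ n) ?leq_max ?leqnn ?orbT //.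
rewrite scaler_sumr -big_split; apply: eq_bigr => i _ /=.
by rewrite scalerA -scalerDl coefD coefZ mulrDl mulrA.
Qed.

Lemma ratxy_natr_eq0 (R : realType) (n : nat) :
  (n%:R == 0 :> ratxy R) = (n == 0%N).
Proof.
have -> : n%:R = tofrac (n%:R%:P%:P : {poly {poly R}}) :> ratxy R.
  by rewrite !polyC_natr rmorph_nat.
by rewrite tofrac_eq0 !polyC_eq0 pnatr_eq0.
Qed.

Lemma rho_expTu (R : realType) (m : nat) : rho (expTu R m) = AexpTu R m.
Proof.
have fact_neq0 : m`!%:R != 0 :> ratxy R.
  by rewrite ratxy_natr_eq0 -lt0n fact_gt0.
rewrite (@rho_widen R _ m.+1); last first.
  by rewrite (leq_trans (size_scale_leq _ _)) // size_polyXn.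
rewrite big_ord_recr /= big1 ?add0r => [|i _].
  by rewrite /expTu coefZ coefXn eqxx mulr1 mulVf // scale1r.
by rewrite /expTu coefZ coefXn ltn_eqF // mulr0 mul0r scale0r.
Qed.

Definition rho_series (R : realType) (f : ncseries {poly ratxy R})
    : ncseries {poly ratxy R} :=
  fun v => rho (f v).

(* Main.v *)
Require Import Defs.
From HB Require Import structures.
From mathcomp Require Import all_boot all_order all_algebra.
From mathcomp Require Import all_classical all_reals all_analysis.
From mathcomp.real_closed Require polyrcf.
From mathcomp Require Import zify ring lra.

Set Implicit Arguments.
Unset Strict Implicit.
Unset Printing Implicit Defensive.

Import Order.TTheory GRing.Theory Num.Theory numFieldNormedType.Exports.
Local Open Scope ring_scope.

(** The truncated sums [f_k(N)] multiply by the harmonic product, and so each of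
    them is [P_k(H_N)] up to a power saving in [N], with [P_k] a polynomial; by
    uniqueness of such expansions [k |-> P_k] is the harmonic regularization.
    The power series [sum_m (f_k(m+1) - f_k(m)) z^m] at [z = M / (M+1)] multiply
    by the shuffle product, and Abel summation turns a power saving in [N] into
    one in [M].  For [k = (1,...,1)] Newton's identities give
    [sum_n P_k u^n = e^{Tu} / A(u)], where
    [A(u) = exp (sum_{n >= 2} (-1)^n zeta(n) u^n / n)], while the power series is
    [L^n / n!], [L] being that of the index (1).  Hence the shuffle regularization
    is [A(d/dT) P_k].

    Dropping a leading 1 of the index is a derivation of the harmonic product, so
    it corresponds to [d/dT].  Splitting an index in two, [(d/dT)^n] of the
    harmonic [zeta_{x,y}] is [(x+y)^n] times the sum over all ways of removing [n]
    consecutive 1s at the cut, and the theorem becomes the identity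
    [A_{x,y}((x+y)u) = A(xu) A(yu)]. *)

(** * Formal power series *)

Section PowerSeriesTheory.
Variable A : comNzRingType.
Implicit Types f g h : nat -> A.

(** A coefficient of a product sees finitely many coefficients, so the ring laws can be borrowed
    from polynomial truncations. *)
Lemma ps_mulE f g n m : (m < n)%N ->
  ps_mul f g m = ((\poly_(i < n) f i) * (\poly_(i < n) g i))`_m.
Proof.
move=> mn; rewrite coefM; apply: eq_bigr => i _.
by rewrite !coef_poly (leq_ltn_trans _ mn) ?leq_ord // (leq_ltn_trans _ mn) ?leq_subr.
Qed.

Lemma eq_ps_mul f1 f2 g1 g2 n :
  (forall m, (m <= n)%N -> f1 m = f2 m) ->
  (forall m, (m <= n)%N -> g1 m = g2 m) -> ps_mul f1 g1 n = ps_mul f2 g2 n.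
Proof.
move=> ef eg; apply: eq_bigr => i _.
by rewrite ef ?leq_ord // eg // leq_subr.
Qed.

Lemma ps_mulC f g n : ps_mul f g n = ps_mul g f n.
Proof. by rewrite !(@ps_mulE _ _ n.+1) // mulrC. Qed.

Lemma ps_mulA f g h n : ps_mul f (ps_mul g h) n = ps_mul (ps_mul f g) h n.
Proof.
have trunc f1 f2 m : (m <= n)%N ->
    ps_mul f1 f2 m = ((\poly_(i < n.+1) f1 i) * (\poly_(i < n.+1) f2 i))`_m.
  by move=> mn; apply: ps_mulE.
transitivity (((\poly_(i < n.+1) f i) * (\poly_(i < n.+1) g i) *
    (\poly_(i < n.+1) h i))`_n); last first.
  rewrite coefM; apply: eq_bigr => i _.
  by rewrite trunc ?leq_ord // coef_poly ltnS leq_subr.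
rewrite -mulrA coefM; apply: eq_bigr => i _.
by rewrite trunc ?leq_subr // coef_poly ltn_ord.
Qed.

Lemma ps_mulDl f g h n :
  ps_mul (fun m => f m + g m) h n = ps_mul f h n + ps_mul g h n.
Proof. by rewrite /ps_mul -big_split; apply: eq_bigr => i _; rewrite mulrDl. Qed.

Lemma ps_mulZl c f g n : ps_mul (fun m => c * f m) g n = c * ps_mul f g n.
Proof. by rewrite /ps_mul mulr_sumr; apply: eq_bigr => i _; rewrite mulrA. Qed.

Lemma ps_mul1r f n : ps_mul (ps1 A) f n = f n.
Proof.
rewrite /ps_mul big_ord_recl /= subn0 /ps1 mul1r big1 ?addr0 // => i _.
by rewrite mul0r.
Qed.

(** The Euler operator u d/du, a derivation which, unlike d/du, shifts no index. *)
Definition ps_theta f : nat -> A := fun n => n%:R * f n.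

Lemma ps_thetaM f g n :
  ps_theta (ps_mul f g) n = ps_mul (ps_theta f) g n + ps_mul f (ps_theta g) n.
Proof.
rewrite /ps_theta /ps_mul mulr_sumr -big_split; apply: eq_bigr => i _ /=.
have {1}-> : n = (i + (n - i))%N by rewrite subnKC // leq_ord.
by rewrite natrD; ring.
Qed.

Lemma ps_theta_pow f j n :
  ps_theta (ps_pow f j.+1) n = j.+1%:R * ps_mul (ps_theta f) (ps_pow f j) n.
Proof.
elim: j n => [|j IHj] n.
  rewrite mul1r -[in RHS]ps_mulC ps_mul1r /ps_theta; congr (_ * _).
  by rewrite /ps_pow /= ps_mulC ps_mul1r.
rewrite /ps_pow iterS -/(ps_pow f j.+1) ps_thetaM.
rewrite (_ : ps_mul f _ n =
    j.+1%:R * ps_mul (ps_theta f) (ps_pow f j.+1) n); last first.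
  rewrite ps_mulC (@eq_ps_mul _ (fun m => j.+1%:R * _ m) f f n (fun m _ => IHj m)) //.
  rewrite ps_mulZl -ps_mulA; congr (_ * _); apply: eq_ps_mul => // m _.
  exact: ps_mulC.
by rewrite -[in RHS]natr1; ring.
Qed.

Lemma ps_pow_small f j n : f 0%N = 0 -> (n < j)%N -> ps_pow f j n = 0.
Proof.
move=> f0; elim: j n => // j IHj n nj.
rewrite /ps_pow iterS -/(ps_pow f j) /ps_mul big_ord_recl f0 mul0r add0r.
rewrite big1 // => i _; rewrite IHj ?mulr0 //=.
by have := ltn_ord i; rewrite /bump /=; case: n nj i => [|n] nj [i /= ni] //; rewrite subSS => _; lia.
Qed.

End PowerSeriesTheory.

(** * Exponentials and first-order equations *)

Section PowerSeriesExp.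
Variable F : fieldType.
Hypothesis F0 : forall n, (n%:R == 0 :> F) = (n == 0%N).
Implicit Types f g h : nat -> F.

Lemma ps_exp0 f : ps_exp f 0 = 1.
Proof. by rewrite /ps_exp big_ord_recl big_ord0 addr0 /= fact0 invr1 mul1r. Qed.

Lemma ps_theta_exp f n : f 0%N = 0 ->
  ps_theta (ps_exp f) n = ps_mul (ps_theta f) (ps_exp f) n.
Proof.
move=> f0; rewrite /ps_theta /ps_exp mulr_sumr big_ord_recl /=.
have -> : n%:R * ((0`!)%:R^-1 * ps_pow f 0 n) = 0.
  by rewrite /ps_pow /= /ps1; case: n => [|n]; rewrite ?mul0r // !mulr0.
rewrite add0r /ps_mul.
have step (i : nat) : n%:R * ((i.+1)`!%:R^-1 * ps_pow f i.+1 n) =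
    \sum_(j < n.+1) (i`!%:R)^-1 * (ps_theta f j * ps_pow f i (n - j)%N).
  rewrite mulrCA -/(ps_theta (ps_pow f i.+1) n) ps_theta_pow factS natrM invfM.
  by rewrite -[_^-1 * _^-1]mulrC -mulrA mulKf ?F0 // /ps_mul mulr_sumr.
under eq_bigr => i _ do rewrite step.
rewrite exchange_big /=; apply: eq_bigr => i _.
(* The term i = 0 is split off because its inner sum exceeds the range j < n; it vanishes with
   [ps_theta f 0]. *)
case: (posnP i) => [->|i_gt0].
  by rewrite /ps_theta !mul0r big1 // => j _; rewrite mul0r mulr0.
rewrite mulr_sumr.
have le : ((n - i).+1 <= n)%N by have := ltn_ord i; lia.
rewrite (big_ord_widen n
  (fun j => ps_theta f i * ((j`!)%:R^-1 * ps_pow f j (n - i)%N)) le).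
rewrite [RHS]big_mkcond /=; apply: eq_bigr => j _.
rewrite mulrCA; case: ifPn => //; rewrite -leqNgt => nij.
by rewrite ps_pow_small ?mulr0.
Qed.

End PowerSeriesExp.

(** Since [g 0] is 0, the equation expresses each coefficient through lower ones. Series identities
    below are proved by comparing logarithmic derivatives in this way. *)
Lemma ps_ode_uniq (D : idomainType) (g h1 h2 : nat -> D) :
  (forall n, (n%:R == 0 :> D) = (n == 0%N)) ->
  g 0%N = 0 -> h1 0%N = h2 0%N ->
  (forall n, ps_theta h1 n = ps_mul g h1 n) ->
  (forall n, ps_theta h2 n = ps_mul g h2 n) -> h1 =1 h2.
Proof.
move=> D0 g0 h0 e1 e2; apply: ltn_ind => -[|n] IHn; first exact: h0.
apply: (@mulfI _ n.+1%:R); first by rewrite D0.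
rewrite -/(ps_theta h1 _) -/(ps_theta h2 _) e1 e2 /ps_mul big_ord_recl [RHS]big_ord_recl g0 !mul0r.
by congr (_ + _); apply: eq_bigr => i _; rewrite IHn // /bump /= subSS; lia.
Qed.

(** * Operators A(d/dT) on polynomials *)

Section ExponentialOperator.
Variable F : fieldType.
Hypothesis F0 : forall n, (n%:R == 0 :> F) = (n == 0%N).
Implicit Types (A : nat -> F) (p : {poly F}).

Definition expT (m : nat) : {poly F} := (m`!%:R)^-1 *: 'X^m.

Lemma polyC_expT p : p = \sum_(m < size p) (p`_m * m`!%:R) *: expT m.
Proof.
rewrite -[LHS]coefK poly_def; apply: eq_bigr => m _.
by rewrite scalerA mulfK // F0 -lt0n fact_gt0.
Qed.

Lemma derivn_expT m j : (expT m)^`(j) = if (j <= m)%N then expT (m - j) else 0.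
Proof.
rewrite /expT derivnZ derivnXn; case: leqP => [jm|mj]; last first.
  by rewrite ffact_small // mulr0n scaler0.
rewrite -scaler_nat scalerA; congr (_ *: _).
rewrite -(ffact_fact jm) natrM invfM mulrAC mulVf ?mul1r // F0.
by rewrite -lt0n ffact_gt0.
Qed.

(* The linear map [e^{Tu} |-> A(u) e^{Tu}]. *)
Definition exp_op A p : {poly F} :=
  \sum_(m < size p) (p`_m * m`!%:R) *: ps_mul (fun n => (A n)%:P) expT m.

(** On the basis T^m/m! differentiation lowers m by one, so the operator is A(d/dT). Any bound n is
    allowed, so that several polynomials can share it. *)
Lemma exp_opE A p n : (size p <= n)%N ->
  exp_op A p = \sum_(j < n) A j *: p^`(j).
Proof.
move=> pn; have {2}-> := polyC_expT p; rewrite /exp_op.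
under [RHS]eq_bigr do rewrite linear_sum scaler_sumr.
rewrite exchange_big /=; apply: eq_bigr => m _.
under eq_bigr do rewrite linearZ /= scalerA mulrC -scalerA derivn_expT.
rewrite -scaler_sumr; congr (_ *: _).
have mn : (m.+1 <= n)%N by apply: leq_trans pn.
rewrite /ps_mul (big_ord_widen n (fun i => (A i)%:P * expT (m - i)) mn) big_mkcond.
by apply: eq_bigr => i _; rewrite ltnS; case: ifP; rewrite ?scaler0 // mul_polyC.
Qed.

End ExponentialOperator.

(** * Indices and uniqueness of regularizations *)

Notation pos1 := (posnat_succ 0).

(** Measures the distance from admissibility; it is the parameter of the inductions on indices
    below. *)
Definition leading_ones (k : mzindex) : nat := find (predC1 pos1) k.
Arguments leading_ones : simpl never.

Lemma pos1P (a : posnat) : reflect (a = pos1) (val a == 1%N).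
Proof. by apply: (iffP eqP) => [a1|->//]; apply: val_inj. Qed.

Lemma admissible_ones k : admissible k = (leading_ones k == 0%N).
Proof.
case: k => [|a k] //=; rewrite /leading_ones /=.
by case: (eqVneq a pos1) => [->|/eqP/pos1P]; case: a => -[|[|n]].
Qed.

Lemma leading_ones_cons a k : leading_ones (a :: k) =
  if a == pos1 then (leading_ones k).+1 else 0%N.
Proof. by rewrite /leading_ones /=; case: eqVneq. Qed.

(** Inserting 1 before or after any leading one gives [pos1 :: k]. An insertion further right leaves
    the leading ones unchanged, and a contraction never adds to them. *)
Lemma stuffle_pos1 k : exists2 s,
  perm_eq (stuffle [:: pos1] k) (nseq (leading_ones k).+1 (pos1 :: k) ++ s) &
  all (fun m => leading_ones m <= leading_ones k)%N s.
Proof.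
elim: k => [|a k [s Ps As]]; first by exists [::].
rewrite [stuffle _ _]/= leading_ones_cons.
case: eqVneq => [->|a1]; last first.
  eexists; first exact: perm_refl.
  rewrite all_cat !all_map /=; apply/andP; split.
    by apply/allP => m _ /=; rewrite leading_ones_cons (negbTE a1).
  rewrite leading_ones_cons; case: eqP => // /(congr1 val) /=.
  by case: (a) => -[].
exists ([seq pos1 :: m | m <- s] ++ [:: posnat_add pos1 pos1 :: k]).
  rewrite catA -cat_cons perm_cat2r /= perm_cons.
  have := perm_map (cons pos1) Ps; rewrite map_cat map_nseq /=.
  by move=> /perm_trans; apply; rewrite perm_refl.
rewrite all_cat all_map /= andbT.
by apply: sub_all As => m /=; rewrite leading_ones_cons eqxx ltnS.
Qed.

Lemma word_of_index_cons a k :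
  word_of_index (a :: k) = nseq (val a).-1 false ++ true :: word_of_index k.
Proof. by rewrite /word_of_index /= cat_rcons. Qed.

Lemma leading_ones_index_of_word n w :
  leading_ones (index_of_word_from n.+1 w) = 0%N.
Proof. by elim: w n => //= -[] w IH n. Qed.

(** The index (1) is the letter y. Inserted next to the leading letters y it gives [pos1 :: k];
    inserted after an x it adds no leading one. *)
Lemma shuffle_pos1 k : exists2 s,
  perm_eq (index_shuffle [:: pos1] k)
    (nseq (leading_ones k).+1 (pos1 :: k) ++ s) &
  all (fun m => leading_ones m <= leading_ones k)%N s.
Proof.
rewrite /index_shuffle (_ : word_of_index [:: pos1] = [:: true]) //.
elim: k => [|a k [s Ps As]]; first by exists [::].
rewrite word_of_index_cons leading_ones_cons.
case: eqVneq => [->|a1] /=; last first.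
  case: a a1 => -[|[|n]] // n_gt0 _; eexists.
    rewrite /= (_ : index_of_word [:: true, false & _] =
        pos1 :: exist _ n.+2 n_gt0 :: k); first exact: perm_refl.
    rewrite -[in RHS](word_of_indexK (_ :: k)) word_of_index_cons //.
  (* All other terms start with x, so their first entry is at least 2. *)
  rewrite all_map; apply/allP => w /mapP[u _ ->].
  by rewrite /index_of_word /= leading_ones_index_of_word.
exists [seq pos1 :: m | m <- s].
  rewrite /index_of_word /= -/index_of_word word_of_indexK perm_cons.
  rewrite -map_comp (eq_map (g := cons pos1 \o index_of_word)) // map_comp.
  by have := perm_map (cons pos1) Ps; rewrite map_cat map_nseq.
rewrite all_map.
by apply: sub_all As => m /=; rewrite leading_ones_cons eqxx ltnS.
Qed.

Lemma index_product_pos1 b k : exists2 s,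
  perm_eq (index_product b [:: pos1] k)
    (nseq (leading_ones k).+1 (pos1 :: k) ++ s) &
  all (fun m => leading_ones m <= leading_ones k)%N s.
Proof. by case: b; [exact: stuffle_pos1 | exact: shuffle_pos1]. Qed.

(* The product [(1) b k] is a nonzero multiple of [1 :: k] plus indices with
   fewer leading ones, so a multiplicative family is determined by its values at
   (1) and at the admissible indices. *)
Lemma index_product_ind b (P : mzindex -> Prop) :
  (forall k, admissible k -> P k) -> P [:: pos1] ->
  (forall k s, perm_eq (index_product b [:: pos1] k)
      (nseq (leading_ones k).+1 (pos1 :: k) ++ s) ->
    P k -> (forall m, m \in s -> P m) -> P (pos1 :: k)) ->
  forall k, P k.
Proof.
move=> Padm P1 Pstep k; have [n] := ubnP (leading_ones k).
elim: n k => // n IHn k; case: (posnP (leading_ones k)) => [/eqP k0 _|].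
  by apply: Padm; rewrite admissible_ones.
case: k => [|a k] //; rewrite leading_ones_cons; case: eqVneq => // -> _.
rewrite ltnS => kn; have [s ps /allP as_] := index_product_pos1 b k.
by apply: Pstep ps _ _ => [|m /as_ mk]; apply: IHn; lia.
Qed.

(** * Uniqueness and derivative of regularizations *)

Section Regularization.
Variable R : realType.

Lemma big_index_product (V : zmodType) b (Z : mzindex -> V) k s :
  perm_eq (index_product b [:: pos1] k)
      (nseq (leading_ones k).+1 (pos1 :: k) ++ s) ->
  \sum_(m <- index_product b [:: pos1] k) Z m =
    Z (pos1 :: k) *+ (leading_ones k).+1 + \sum_(m <- s) Z m.
Proof.
by move=> ps; rewrite (perm_big _ ps) big_cat big_nseq iter_addr_0.
Qed.

Lemma is_regularization_uniq b (Z1 Z2 : mzindex -> {poly R}) :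
  is_regularization b Z1 -> is_regularization b Z2 -> Z1 = Z2.
Proof.
move=> [a1 x1 m1] [a2 x2 m2]; apply/funext; apply: (index_product_ind (b := b)).
- by move=> k ka; rewrite a1 ?a2.
- by rewrite x1 x2.
move=> k s ps ek es; have e := congr1 (fun p => 'X * p) ek.
rewrite -{1}x1 -x2 m1 m2 !(big_index_product _ ps) in e.
rewrite (eq_big_seq _ es) in e; move/addIr: e => /eqP.
by rewrite -subr_eq0 -mulrnBl -mulr_natl mulf_eq0 -polyC_natr polyC_eq0
  pnatr_eq0 /= subr_eq0 => /eqP.
Qed.

(** By uniqueness, exhibiting any regularization computes the choice made in [zeta_reg]. *)
Lemma zeta_regP b (Z : mzindex -> {poly R}) :
  is_regularization b Z -> zeta_reg R b = Z.
Proof.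
move=> ZP; rewrite /zeta_reg; case: xgetP => [Z' _ Z'P|/(_ Z)//].
exact: is_regularization_uniq Z'P ZP.
Qed.

(** The deletion acts on the family Z rather than on indices because its result can be zero, which
    is not an index. *)
Definition drop_pos1 (V : zmodType) (Z : mzindex -> V) (k : mzindex) : V :=
  if k is a :: k' then if a == pos1 then Z k' else 0 else 0.

(* Dropping a leading one is a derivation of the harmonic product, because
   the contracted letter [a + b] is never 1. *)
Lemma stuffle_drop_pos1 (A : comNzRingType) (Z : mzindex -> A) :
  Z [::] = 1 ->
  (forall k l, Z k * Z l = \sum_(m <- stuffle k l) Z m) ->
  forall k l, \sum_(m <- stuffle k l) drop_pos1 Z m =
    drop_pos1 Z k * Z l + Z k * drop_pos1 Z l.
Proof.
move=> Z0 ZM [|a k] l.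
  by rewrite /= big_cons big_nil addr0 Z0 mul0r mul1r add0r.
case: l => [|b l]; first by rewrite big_cons big_nil addr0 Z0 mulr0 addr0 mulr1.
rewrite [stuffle _ _]/= !big_cat !big_map /= [X in _ + (_ + X)]big1_seq; last first.
  move=> m _ /=; case: eqP => // /(congr1 val) /=.
  by have := valP a; have := valP b; rewrite /=; lia.
rewrite addr0; congr (_ + _).
  case: eqP => _; last by rewrite big1 // mul0r.
  by rewrite ZM.
case: eqP => _; last by rewrite big1 // mulr0.
by rewrite ZM.
Qed.

Lemma mzv_nil : mzv R [::] = 1.
Proof. by rewrite /mzv; apply/cvg_lim => //; exact: cvg_cst. Qed.

(** Both d/dT and the deletion of a leading one are derivations, so the product of (1) and k yields
    the case [pos1 :: k] from indices with fewer leading ones. *)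
Lemma deriv_regularization (Z : mzindex -> {poly R}) :
  is_regularization Harmonic Z -> forall k, (Z k)^`() = drop_pos1 Z k.
Proof.
move=> [Za Z1 ZM]; have Z0 : Z [::] = 1 by rewrite Za // mzv_nil.
apply: (index_product_ind (b := Harmonic)) => [k ka||k s ps ek es].
- rewrite Za // derivC; case: k ka => //= a k.
  by case: eqP => // ->.
- by rewrite Z1 derivX /= Z0.
have e := congr1 deriv (ZM [:: pos1] k).
rewrite derivM ek Z1 derivX -[1]Z0 -[Z [::]]/(drop_pos1 Z [:: pos1]) -Z1 in e.
rewrite -stuffle_drop_pos1 // (big_morph _ (@derivD R) (@deriv0 R)) in e.
rewrite !(big_index_product (b := Harmonic) _ ps) (eq_big_seq _ es) in e.
move/addIr: e => /eqP.
by rewrite -subr_eq0 -mulrnBl -mulr_natl mulf_eq0 -polyC_natr polyC_eq0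
  pnatr_eq0 /= subr_eq0 eq_sym => /eqP.
Qed.

End Regularization.

(** * Truncated multiple zeta sums *)

Arguments mzv_trunc : simpl never.

Section TruncatedSums.
Variable R : realType.
Local Notation tr := (mzv_trunc R).

(** At N = 0 the convention 0^-1 = 0 kills the added term. *)
Lemma mzv_truncS a k N :
  tr (a :: k) N.+1 = tr (a :: k) N + (N%:R ^+ val a)^-1 * tr k N.
Proof.
rewrite /mzv_trunc -/(mzv_trunc R k); case: N => [|N]; last by rewrite big_nat_recr.
by rewrite !big_geq // expr0n gtn_eqF ?(valP a) //= invr0 mul0r addr0.
Qed.

Lemma mzv_trunc0 a k : tr (a :: k) 0 = 0.
Proof. by rewrite /mzv_trunc big_geq. Qed.

(** Multiplying the recurrences of both factors in N creates three new terms, which match the three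
    clauses of [stuffle]. *)
Lemma mzv_trunc_stuffle k l N :
  tr k N * tr l N = \sum_(m <- stuffle k l) tr m N.
Proof.
elim: k l N => [|a k IHk] l N; first by rewrite big_cons big_nil mul1r addr0.
elim: l N => [|b l IHl] N; first by rewrite big_cons big_nil mulr1 addr0.
rewrite [stuffle _ _]/= !big_cat !big_map /=.
elim: N => [|N IHN].
  rewrite !mzv_trunc0 mul0r !big1 ?addr0 // => m _; exact: mzv_trunc0.
under eq_bigr do rewrite mzv_truncS.
under [X in _ + (X + _)]eq_bigr do rewrite mzv_truncS.
under [X in _ + (_ + X)]eq_bigr do rewrite mzv_truncS.
rewrite !big_split /= -!mulr_sumr !mzv_truncS.
rewrite -(IHk (b :: l)) -IHk -(IHl N) /= exprD invfM.
rewrite mulrDl !mulrDr IHN; ring.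
Qed.

Lemma mzv_trunc_ge0 k N : 0 <= tr k N.
Proof.
elim: k N => [|a k IHk] N; first exact: ler01.
by rewrite /mzv_trunc -/(mzv_trunc R k); apply: sumr_ge0 => m _; rewrite mulr_ge0 // invr_ge0 exprn_ge0.
Qed.

Lemma mzv_trunc_nondecreasing k : {homo tr k : M N / (M <= N)%N >-> M <= N}.
Proof.
apply: homo_leq => // [x y z|N]; first exact: le_trans.
case: k => [|a k]; first exact: lexx.
rewrite mzv_truncS lerDl.
by rewrite mulr_ge0 ?mzv_trunc_ge0 // invr_ge0 exprn_ge0.
Qed.

(** The harmonic number of N - 1, as the truncation is strict. *)
Definition harm : nat -> R := tr [:: pos1].

Lemma harmS N : harm N.+1 = harm N + N%:R^-1.
Proof. by rewrite /harm mzv_truncS mulr1 expr1. Qed.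

Lemma harm_ge0 N : 0 <= harm N. Proof. exact: mzv_trunc_ge0. Qed.

Lemma harm_nondecreasing : {homo harm : M N / (M <= N)%N >-> M <= N}.
Proof. exact: mzv_trunc_nondecreasing. Qed.

(** The inner sum is replaced by its largest value and the exponent by 1. Iteration bounds truncated
    sums by powers of [harm]. *)
Lemma mzv_trunc_cons_le a k N : tr (a :: k) N <= harm N * tr k N.
Proof.
elim: N => [|N IHN]; first by rewrite mzv_trunc0 mulr_ge0 ?harm_ge0 ?mzv_trunc_ge0.
rewrite mzv_truncS.
apply: le_trans (_ : harm N.+1 * tr k N <= _); last first.
  by rewrite ler_wpM2l ?harm_ge0 // mzv_trunc_nondecreasing.
rewrite harmS mulrDl lerD // ler_wpM2r ?mzv_trunc_ge0 //.
case: N {IHN} => [|N]; first by rewrite expr0n gtn_eqF ?(valP a) //= invr0.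
rewrite lef_pV2 ?posrE ?exprn_gt0 ?ltr0n //.
by rewrite ler_eXnr ?(valP a) // ler1n.
Qed.

(** With the converse bound below, [expR (harm N)] has the order of N, and [harm] replaces the
    logarithm. *)
Lemma expR_harm_ge N : N%:R <= expR (harm N).
Proof.
elim: N => [|[|N] IHN]; first exact: expR_ge0.
  by rewrite -[1%:R]expR0 ler_expR harm_ge0.
rewrite harmS expRD -[N.+2]addn1 natrD.
apply: le_trans (_ : N.+1%:R * (1 + N.+1%:R^-1) <= _).
  by rewrite mulrDr mulr1 divff.
by rewrite ler_pM ?addr_ge0 ?invr_ge0 // expR_ge1Dx.
Qed.

Lemma expR_harm_le N : (0 < N)%N -> expR (harm N) <= expR 1 * N%:R.
Proof.
have pos x : 0 <= expR x :> R by exact: expR_ge0.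
case: N => [|[|N]] // _.
  by rewrite harmS /harm mzv_trunc0 invr0 addr0 mulr1 ler_expR.
(* The induction runs on this sharper bound, which is preserved because exp(-1/n) >= 1 - 1/n. *)
apply: le_trans (_ : expR 1 * N.+1%:R <= _); last first.
  by rewrite ler_wpM2l ?pos // ler_nat.
elim: N => [|N IHN].
  by rewrite !harmS /harm mzv_trunc0 invr0 add0r invr1 add0r mulr1.
rewrite harmS expRD.
apply: le_trans (ler_wpM2r (pos _) IHN) _; rewrite -mulrA ler_wpM2l //.
have := expR_ge1Dx (- (N.+2%:R^-1) : R); rewrite expRN.
have := expR_gt0 (N.+2%:R^-1 : R); set x := expR _ => x0 h.
rewrite -ler_pdivlMr // (le_trans _ (ler_wpM2l (ler0n _ N.+2) h)) //.
by rewrite mulrBr mulr1 divff // -[N.+2%:R]natr1 addrK.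
Qed.

End TruncatedSums.

(** * Expansions up to a power saving *)

Section Gauge.
Variable R : realType.
Implicit Types (f g l : nat -> R) (p q : {poly R}).
Local Notation harm := (harm R).

(** Growth below every positive power of N. *)
Definition subexp g := forall d, 0 < d ->
  exists C, forall N, `|g N| <= C * expR (d * harm N).

(* [expR (- harm N)] has the order of [1 / N], so this is a power saving. *)
Definition negl g := exists2 e, 0 < e <= 4^-1 &
  exists C, forall N, `|g N| <= C * expR (- e * harm N).

Lemma bound_ge0 (g : nat -> R) (C x : R) : `|g 0%N| <= C * expR x -> 0 <= C.
Proof. by move=> /(le_trans (normr_ge0 _)); rewrite pmulr_lge0 ?expR_gt0. Qed.

Lemma subexp_cst c : subexp (fun=> c).
Proof.
move=> d d0; exists `|c| => N; rewrite ler_peMr // -expR0 ler_expR.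
by rewrite mulr_ge0 ?harm_ge0 // ltW.
Qed.

Lemma subexpD f g : subexp f -> subexp g -> subexp (fun N => f N + g N).
Proof.
move=> fs gs d d0; have [C fC] := fs _ d0; have [D gD] := gs _ d0.
by exists (C + D) => N; rewrite (le_trans (ler_normD _ _)) // mulrDl lerD.
Qed.

Lemma subexpM f g : subexp f -> subexp g -> subexp (fun N => f N * g N).
Proof.
move=> fs gs d d0; have d2 : 0 < d / 2 by lra.
have [C fC] := fs _ d2; have [D gD] := gs _ d2; exists (C * D) => N.
rewrite [d]splitr mulrDl expRD mulrACA normrM.
by rewrite ler_pM.
Qed.

Lemma le_subexp f g : (forall N, `|f N| <= `|g N|) -> subexp g -> subexp f.
Proof.
move=> fg gs d /gs[C gC]; exists C => N; exact: le_trans (fg N) (gC N).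
Qed.

Lemma subexp_harm : subexp harm.
Proof.
move=> d d0; exists d^-1 => N.
rewrite ger0_norm ?harm_ge0 // mulrC ler_pdivlMr // mulrC.
by apply: le_trans (expR_ge1Dx _); rewrite lerDr.
Qed.

Lemma subexp_horner l p : subexp l -> subexp (fun N => p.[l N]).
Proof.
move=> ls; elim/poly_ind: p => [|p c IHp].
  by apply: le_subexp (subexp_cst 0) => N; rewrite horner0.
apply: le_subexp (subexpD (subexpM IHp ls) (subexp_cst c)) => N.
by rewrite hornerMXaddC.
Qed.

Lemma eq_negl f g : f =1 g -> negl f -> negl g.
Proof. by move=> /funext ->. Qed.

Lemma negl0 : negl (fun=> 0).
Proof.
exists 4^-1; first by rewrite lexx andbT invr_gt0.
by exists 0 => N; rewrite normr0 mul0r.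
Qed.

Lemma negl_weaken g e e' C : 0 < e' -> e' <= e ->
  (forall N, `|g N| <= C * expR (- e * harm N)) ->
  forall N, `|g N| <= C * expR (- e' * harm N).
Proof.
move=> e'0 ee' gC N; rewrite (le_trans (gC N)) // ler_wpM2l ?(bound_ge0 (gC _)) //.
by rewrite ler_expR ler_wpM2r ?harm_ge0 // lerN2.
Qed.

Lemma neglD f g : negl f -> negl g -> negl (fun N => f N + g N).
Proof.
move=> [d /andP[d0 d4] [C fC]] [e /andP[e0 e4] [D gD]].
have m0 : 0 < Num.min d e by rewrite lt_min d0.
exists (Num.min d e); first by rewrite m0 ge_min d4.
exists (C + D) => N; rewrite (le_trans (ler_normD _ _)) // mulrDl.
by rewrite lerD // (negl_weaken m0 _ fC, negl_weaken m0 _ gD) ?ge_min ?lexx ?orbT.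
Qed.

(** Half of the saving is spent on the subexponential factor. *)
Lemma neglMl f g : subexp f -> negl g -> negl (fun N => f N * g N).
Proof.
move=> fs [e /andP[e0 e4] [D gD]]; have e2 : 0 < e / 2 by lra.
exists (e / 2); first by apply/andP; split; lra.
have [C fC] := fs _ e2; exists (C * D) => N.
rewrite (_ : - (e / 2) = e / 2 + - e); last by lra.
by rewrite mulrDl expRD mulrACA normrM ler_pM.
Qed.

Lemma neglZ c g : negl g -> negl (fun N => c * g N).
Proof. exact/neglMl/subexp_cst. Qed.

Lemma neglN g : negl g -> negl (fun N => - g N).
Proof. by move/(neglZ (-1)); apply: eq_negl => N; rewrite mulN1r. Qed.

Lemma neglB f g : negl f -> negl g -> negl (fun N => f N - g N).
Proof. by move=> nf /neglN; apply: neglD. Qed.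

Lemma negl_sum (I : eqType) (s : seq I) (F : I -> nat -> R) :
  (forall i, i \in s -> negl (F i)) -> negl (fun N => \sum_(i <- s) F i N).
Proof.
elim: s => [|i s IHs] Fs; first by apply: eq_negl negl0 => N; rewrite big_nil.
apply: eq_negl (fun N => F i N + \sum_(i <- s) F i N) _ _ _ => [N|].
  by rewrite big_cons.
by apply: neglD; [|apply: IHs => j js]; apply: Fs; rewrite inE ?eqxx ?js ?orbT.
Qed.

Lemma negl_subexp g : negl g -> subexp g.
Proof.
move=> [e /andP[e0 _] [C gC]] d d0; exists C => N.
rewrite (le_trans (gC N)) // ler_wpM2l ?(bound_ge0 (gC _)) // ler_expR.
by rewrite ler_wpM2r ?harm_ge0 //; lra.
Qed.

Lemma negl_small g (x : R) : 0 < x -> negl g ->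
  exists n, forall N, (n <= N)%N -> `|g N| < x.
Proof.
move=> x0 [e /andP[e0 _] [C gC]]; have C0 := bound_ge0 (gC _).
(* Beyond this n, e times [harm N] exceeds C / x, and exp t >= t concludes. *)
have [n nP] : exists n : nat, expR (C / x / e) < n%:R.
  by exists (Num.bound (expR (C / x / e))); rewrite archi_boundP ?expR_ge0.
exists n => N nN; apply: le_lt_trans (gC N) _.
have : C / x / e < harm N.
  rewrite -ltr_expR (lt_le_trans nP) // (le_trans _ (expR_harm_ge R N)) //.
  by rewrite ler_nat.
rewrite ltr_pdivrMr // => h; rewrite mulNr expRN ltr_pdivrMr ?expR_gt0 //.
rewrite -ltr_pdivrMl // mulrC (lt_le_trans h) // mulrC.
by apply: le_trans (expR_ge1Dx _); rewrite lerDr.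
Qed.

(** * Polynomial expansions in a scale close to [harm] *)

Definition harm_like l := forall N, harm N - 1 <= l N <= harm N + 2.

Lemma harm_like_harm : harm_like harm.
Proof. by move=> N; apply/andP; split; lra. Qed.

Lemma harm_like_subexp l : harm_like l -> subexp l.
Proof.
move=> ll; apply: le_subexp (subexpD subexp_harm (subexp_cst 2)) => N.
have := harm_ge0 R N; have /andP[] := ll N; rewrite ler_norml.
move=> h1 h2 h0; rewrite ger0_norm; last lra.
by apply/andP; split; lra.
Qed.

(** The scale l is [harm] on the harmonic side and the polylogarithm of (1) on the shuffle side. *)
Definition asymp l f p := negl (fun N => f N - p.[l N]).

(** Along l, which tends to infinity, a nonzero polynomial stays away from 0, whereas p - q becomes
    arbitrarily small. *)
Lemma asymp_uniq l f p q : harm_like l -> asymp l f p -> asymp l f q -> p = q.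
Proof.
move=> ll fp fq.
have : negl (fun N => (p - q).[l N]).
  by apply: eq_negl (neglB fq fp) => N; rewrite hornerD hornerN; ring.
move: (p - q) (subr_eq0 p q) => d dpq dn.
case: (eqVneq d 0) => [/eqP|d0]; first by rewrite dpq => /eqP.
wlog lc0 : d d0 dn {dpq fp fq} / 0 < lead_coef d.
  move=> W; case: (ltgtP (lead_coef d) 0) => [lt0|gt0|/eqP].
  - apply: (W (- d)); rewrite ?oppr_eq0 // ?lead_coefN ?oppr_gt0 //.
    by apply: eq_negl (neglN dn) => N; rewrite hornerN.
  - exact: (W d).
  - by rewrite lead_coef_eq0 (negbTE d0).
have [x xP] := polyrcf.poly_pinfty_gt_lc lc0.
have [n nP] := negl_small lc0 dn.
(* N lies past n and makes l N >= harm N - 1 >= x, where d is at least its leading coefficient. *)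
pose N := maxn n (Num.bound (expR (x + 1))).
have := nP N (leq_maxl _ _); rewrite ltNge (le_trans _ (ler_norm _)) // xP //.
have /andP[+ _] := ll N; apply: le_trans; rewrite lerBrDr -ler_expR.
apply: le_trans (expR_harm_ge R N); apply: le_trans (ltW (archi_boundP (expR_ge0 _))) _.
by rewrite ler_nat leq_maxr.
Qed.

Lemma asympD l f g p q :
  asymp l f p -> asymp l g q -> asymp l (fun N => f N + g N) (p + q).
Proof. by move=> fp gq; apply: eq_negl (neglD fp gq) => N; rewrite hornerD; ring. Qed.

Lemma asympZ l c f p : asymp l f p -> asymp l (fun N => c * f N) (c *: p).
Proof. by move=> fp; apply: eq_negl (neglZ c fp) => N; rewrite hornerZ; ring. Qed.

Lemma asympM l f g p q : harm_like l ->
  asymp l f p -> asymp l g q -> asymp l (fun N => f N * g N) (p * q).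
Proof.
move=> ll fp gq.
have sub r : subexp (fun N => r.[l N]) by exact/subexp_horner/harm_like_subexp.
(* The error is (f - p)(g - q) + p (g - q) + q (f - p). *)
have fg := neglMl (negl_subexp fp) gq.
apply: eq_negl (neglD fg (neglD (neglMl (sub p) gq) (neglMl (sub q) fp))) => N.
by rewrite hornerM; ring.
Qed.

Lemma asymp_sum l (I : eqType) (s : seq I) (F : I -> nat -> R) P :
  (forall i, i \in s -> asymp l (F i) (P i)) ->
  asymp l (fun N => \sum_(i <- s) F i N) (\sum_(i <- s) P i).
Proof.
move=> /negl_sum; apply: eq_negl => N.
by rewrite sumrB horner_sum.
Qed.

Lemma eq_asymp l f g p : f =1 g -> asymp l f p -> asymp l g p.
Proof. by move=> /funext ->. Qed.

Lemma asymp_cst l c : asymp l (fun=> c) c%:P.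
Proof. by apply: eq_negl negl0 => N; rewrite hornerC subrr. Qed.

Lemma asymp_id l : asymp l l 'X.
Proof. by apply: eq_negl negl0 => N; rewrite hornerX subrr. Qed.

(** * Growth and tails of truncated sums *)

Lemma mzv_trunc_subexp k : subexp (mzv_trunc R k).
Proof.
elim: k => [|a k IHk]; first exact: subexp_cst.
apply: le_subexp (subexpM subexp_harm IHk) => N.
by rewrite !ger0_norm ?mulr_ge0 ?harm_ge0 ?mzv_trunc_ge0 ?mzv_trunc_cons_le.
Qed.

(** Let W m = exp(- harm m / 4). In an increment, one factor 1/m saves exp(- harm m) and the inner
    sum costs exp(3/4 harm m). What remains is a multiple of W m / m, bounded by the decrease of W,
    and the sum telescopes. *)
Lemma mzv_trunc_tail k : admissible k -> exists C, forall N M, (N <= M)%N ->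
  mzv_trunc R k M - mzv_trunc R k N <= C * expR (- 4^-1 * harm N).
Proof.
case: k => [_|a k adm].
  by exists 0 => N M _; rewrite subrr mul0r.
have e0 : 0 < 4^-1 :> R by rewrite invr_gt0.
have d0 : 0 < 1 - 4^-1 :> R by lra.
have [C fC] := mzv_trunc_subexp k d0; have C0 := bound_ge0 (fC 0%N).
set W := fun N => expR (- 4^-1 * harm N); set E : R := expR 1.
have E0 : 0 < E := expR_gt0 _.
have K0 : 0 <= E * C * 5 by rewrite !mulr_ge0 // ltW.
suff H m : (m%:R ^+ val a)^-1 * mzv_trunc R k m <=
    E * C * 5 * (W m - W m.+1).
  exists (E * C * 5) => N M /subnKC <-.
  apply: le_trans (_ : E * C * 5 * (W N - W (N + (M - N))%N) <= _); last first.
    by rewrite ler_wpM2l // gerBl expR_ge0.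
  elim: (M - N)%N => [|i IHi]; first by rewrite addn0 !subrr mulr0.
  rewrite addnS mzv_truncS; have := H (N + i)%N; lra.
case: m => [|m].
  rewrite expr0n gtn_eqF ?(valP a) //= invr0 mul0r mulr_ge0 //.
  by rewrite /W harmS invr0 addr0 subrr.
have m0 : 0 < m.+1%:R :> R by rewrite ltr0n.
have fm := fC m.+1; rewrite ger0_norm ?mzv_trunc_ge0 // in fm.
have -> : W m.+2 = W m.+1 * expR (- (4^-1 * m.+1%:R^-1)).
  by rewrite /W harmS mulrDr expRD mulNr mulNr.
have hm := @expR_harm_le R m.+1 isT.
have im : m.+1%:R^-1 <= E * expR (- harm m.+1).
  by rewrite expRN -ler_pdivrMr ?invr_gt0 ?expR_gt0 // invrK ler_pdivrMl // mulrC.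
apply: le_trans (_ : m.+1%:R^-1 * (E * C * W m.+1) <= _).
  apply: le_trans (_ : (m.+1%:R ^+ 2)^-1 * mzv_trunc R k m.+1 <= _).
    rewrite ler_wpM2r ?mzv_trunc_ge0 // lef_pV2 ?posrE ?exprn_gt0 //.
    by rewrite ler_weXn2l ?ler1n.
  rewrite expr2 invfM -[leLHS]mulrA ler_wpM2l ?invr_ge0 //.
  have i0 : 0 <= m.+1%:R^-1 :> R by rewrite invr_ge0 ltW.
  have h := ler_pM i0 (mzv_trunc_ge0 R k m.+1) im fm; apply: (le_trans h).
  rewrite mulrACA -expRD le_eqVlt; apply/orP; left; apply/eqP.
  by congr (_ * expR _); lra.
set x := m.+1%:R^-1 in im *; have x0 : 0 < x by rewrite invr_gt0.
rewrite (_ : x * _ = E * C * W m.+1 * x); last by ring.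
rewrite (_ : _ * (W _ - _) =
    E * C * W m.+1 * (5 * (1 - expR (- (4^-1 * x))))); last by ring.
rewrite ler_wpM2l ?mulr_ge0 ?expR_ge0 // expRN.
have x1 : x <= 1 by rewrite invf_le1 // ler1n.
have h := expR_ge1Dx (4^-1 * x); have h0 := expR_gt0 (4^-1 * x).
(* The constant 5: exp(-x/4) <= 1/(1 + x/4) <= 1 - x/5 for 0 < x <= 1. *)
have : (expR (4^-1 * x))^-1 <= (1 + 4^-1 * x)^-1 by rewrite lef_pV2 ?posrE //; lra.
have : (1 + 4^-1 * x)^-1 <= 1 - x / 5; last by lra.
rewrite invf_ple ?posrE; [|lra|lra].
rewrite -[_^-1]mul1r ler_pdivrMr; last by lra.
nra.
Qed.

End Gauge.

(** * The harmonic regularization *)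

Section HarmonicRegularization.
Variable R : realType.
Local Notation tr := (mzv_trunc R).
Local Notation harm := (harm R).

(** The tail bound is uniform in the upper end, so it gives both convergence and its rate. *)
Lemma mzv_asymp k : admissible k -> asymp harm (tr k) (mzv R k)%:P.
Proof.
move=> /(@mzv_trunc_tail R)[C tail].
have nd : nondecreasing_seq (tr k) by exact: mzv_trunc_nondecreasing.
have cv : cvgn (tr k).
  apply: nondecreasing_is_cvgn => //.
  exists (tr k 0%N + C * expR (- 4^-1 * harm 0)) => _ [N _ <-].
  by rewrite addrC -lerBlDr tail.
exists 4^-1; first by rewrite lexx invr_gt0 ltr0n.
exists C => N; rewrite hornerC ler0_norm; last first.
  by rewrite subr_le0; apply: nondecreasing_cvgn_le.
rewrite opprB lerBlDr; apply: limr_le => //.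
by exists N => // M /= NM; rewrite -lerBlDr tail.
Qed.

Definition zeta_star (k : mzindex) : {poly R} := xget 0 [set p | asymp harm (tr k) p].

Lemma zeta_starP k : asymp harm (tr k) (zeta_star k).
Proof.
suff [p pP] : exists p, asymp harm (tr k) p by apply: xgetPex (ex_intro _ p pP).
move: k; apply: (index_product_ind (b := Harmonic)) => [k /mzv_asymp kP||k s ps [p pP] sP].
- by exists (mzv R k)%:P.
- by exists 'X; exact: asymp_id.
have sP' m : m \in s -> asymp harm (tr m) (zeta_star m).
  by move=> /sP[q qP]; apply: xgetPex (ex_intro _ q qP).
pose n := (leading_ones k).+1.
(* The product of (1) and k, solved for the expansion of [pos1 :: k]. *)
exists (n%:R^-1 *: ('X * p + (-1) *: \sum_(m <- s) zeta_star m)).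
have := asympZ n%:R^-1 (asympD (asympM (harm_like_harm R) (asymp_id harm) pP)
  (asympZ (-1) (asymp_sum sP'))).
apply: eq_asymp => N.
rewrite mzv_trunc_stuffle (big_index_product (b := Harmonic) (tr^~ N) ps).
by rewrite /= -/n -(mulr_natl (tr _ _)) mulN1r addrK mulKf // pnatr_eq0.
Qed.

Lemma zeta_star_uniq k p : asymp harm (tr k) p -> zeta_star k = p.
Proof. exact: asymp_uniq (harm_like_harm R) (zeta_starP k). Qed.

(** The product relation is exact for truncated sums; uniqueness of expansions carries it to the
    polynomials. *)
Lemma zeta_star_regularization : is_regularization Harmonic zeta_star.
Proof.
split=> [k kadm||k l]; first exact/zeta_star_uniq/mzv_asymp.
  exact/zeta_star_uniq/asymp_id.
have kl := asympM (harm_like_harm R) (zeta_starP k) (zeta_starP l).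
apply: asymp_uniq (harm_like_harm R) kl _.
apply: eq_asymp (asymp_sum (fun m _ => zeta_starP m)) => N.
by rewrite mzv_trunc_stuffle.
Qed.

(** Newton's identities for the elementary symmetric functions and power sums of the 1/m with 0 < m
    < N, by induction on the number of variables. *)
Lemma mzv_trunc_newton n N : n.+1%:R * tr (nseq n.+1 pos1) N =
  \sum_(i < n.+1) (-1) ^+ i * tr (nseq (n - i) pos1) N * tr [:: posnat_succ i] N.
Proof.
elim: N n => [|N IHN] n.
  rewrite mzv_trunc0 mulr0 big1 // => i _; by rewrite mzv_trunc0 mulr0.
pose t : R := N%:R^-1; pose e j := tr (nseq j pos1) N.
pose p i := tr [:: posnat_succ i] N.
have eS j : tr (nseq j.+1 pos1) N.+1 = e j.+1 + t * e j by rewrite mzv_truncS.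
have pS i : tr [:: posnat_succ i] N.+1 = p i + t ^+ i.+1.
  by rewrite mzv_truncS mulr1 exprVn.
rewrite eS; under eq_bigr do rewrite pS.
rewrite big_ord_recr /= subnn mulr1.
have -> : \sum_(i < n) (-1) ^+ i * tr (nseq (n - i) pos1) N.+1 * (p i + t ^+ i.+1) =
    \sum_(i < n) (-1) ^+ i * e (n - i)%N * p i +
    t * (n%:R * e n) + (t * e n - (-1) ^+ n * t ^+ n.+1).
  case: n => [|n].
    by rewrite !big_ord0 mul0r mulr0 expr0 expr1 /e /= !mulr1 mul1r subrr !addr0.
  rewrite (IHN n) mulr_sumr -big_split /=.
  (* The terms free of power sums are [a i - a i.+1] and telescope. *)
  pose a i := (-1) ^+ i * e (n.+1 - i)%N * t ^+ i.+1.
  have -> : t * e n.+1 - (-1) ^+ n.+1 * t ^+ n.+2 = - (a n.+1 - a 0%N).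
    rewrite /a subnn subn0 expr1 (_ : e 0%N = 1) // expr0; ring.
  rewrite -telescope_sumr // big_mkord -sumrN -big_split /=.
  apply: eq_bigr => i _; rewrite /a subSS subSn ?leq_ord // eS.
  rewrite -/(e (n - i)%N) -/(p i) !exprS; ring.
have := IHN n; rewrite big_ord_recr /= subnn mulr1 -/(e n.+1) -/(p n) => h.
by rewrite mulrDr h -[n.+1%:R]natr1; ring.
Qed.

(** The coefficients of log A(u). *)
Definition exp_coeff : nat -> R := fun n => if (n < 2)%N then 0 else
  (-1) ^+ n / n%:R * mzv R [:: posnat_succ n.-1].

(** Both sides start at 1 and have logarithmic derivative T u under [ps_theta]: Newton's identities
    give the contribution of the (1,...,1), and the values zeta(n), n >= 2, cancel against those
    from A. *)
Lemma zeta_star_ones n :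
  ps_mul (fun j => (ps_exp exp_coeff j)%:P) (fun j => zeta_star (nseq j pos1)) n =
  expT R n.
Proof.
have R0 m : (m%:R == 0 :> R) = (m == 0%N) by rewrite pnatr_eq0.
pose A j := (ps_exp exp_coeff j)%:P; pose z j := zeta_star (nseq j pos1).
pose b j : {poly R} :=
  if j is i.+1 then (-1) ^+ i * zeta_star [:: posnat_succ i] else 0.
pose c j := (ps_theta exp_coeff j)%:P.
have z0 : z 0%N = 1 by exact/zeta_star_uniq/asymp_cst.
have A0 : A 0%N = 1 by rewrite /A ps_exp0.
have zE j : ps_theta z j = ps_mul b z j.
  rewrite /ps_theta; case: j => [|j].
    by rewrite mul0r /ps_mul big_ord1 mul0r.
  rewrite /ps_mul big_ord_recl mul0r add0r.
  rewrite mulr_natl -scaler_nat.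
  apply: asymp_uniq (harm_like_harm R) (asympZ j.+1%:R (zeta_starP _)) _.
  apply: eq_asymp (fun N => esym (mzv_trunc_newton j N)) _.
  apply: asymp_sum => i _; rewrite /= /bump /= add0n.
  have -> : (-1) ^+ i = ((-1) ^+ i)%:P :> {poly R}.
    by rewrite rmorphXn rmorphN1.
  rewrite mulrAC -mulrA mul_polyC; apply: eq_asymp (asympZ ((-1) ^+ i)
    (asympM (harm_like_harm R) (zeta_starP (nseq (j - i) pos1))
      (zeta_starP [:: posnat_succ i]))) => N.
  by rewrite mulrA.
have AE j : ps_theta A j = ps_mul c A j.
  rewrite /ps_theta /A -polyC_natr -polyCM -/(ps_theta _ j).
  rewrite ps_theta_exp // /ps_mul rmorph_sum.
  by apply: eq_bigr => i _; rewrite rmorphM.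
pose g j := b j + c j.
have gE j : g j = if j == 1%N then 'X else 0.
  have [_ X1 _] := zeta_star_regularization.
  rewrite /g /c /ps_theta; case: j => [|[|j]]; rewrite /= ?mul0r ?mulr0 ?polyC0 ?addr0 //.
    by rewrite mul1r X1.
  have [Za _ _] := zeta_star_regularization; rewrite Za //.
  rewrite (_ : (-1) ^+ j.+1 = ((-1) ^+ j.+1)%:P); last by rewrite rmorphXn rmorphN1.
  rewrite -polyCM -polyCD [X in _ + X]mulrA (mulrC j.+2%:R) mulfVK ?R0 //.
  by rewrite [in X in _ + X]exprS mulN1r mulNr subrr.
apply: (@ps_ode_uniq _ g (ps_mul A z) (expT R)) => {n}.
- by move=> m; rewrite -polyC_natr polyC_eq0 R0.
- by rewrite gE.
- by rewrite /ps_mul big_ord1 z0 A0 mulr1 /expT fact0 invr1 scale1r.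
- move=> n; rewrite ps_thetaM.
  rewrite (eq_ps_mul (fun m _ => AE m) (fun m _ => erefl)) -ps_mulA.
  rewrite (eq_ps_mul (fun m _ => erefl) (fun m _ => zE m)).
  rewrite (ps_mulA A b z) (eq_ps_mul (fun m _ => ps_mulC A b m) (fun m _ => erefl)).
  by rewrite -(ps_mulA b A z) addrC -ps_mulDl.
move=> n; rewrite /ps_theta /ps_mul; case: n => [|n].
  by rewrite mul0r big_ord1 gE mul0r.
rewrite big_ord_recl gE mul0r add0r big_ord_recl gE /= big1 ?addr0; last first.
  by move=> i _; rewrite gE mul0r.
rewrite subn1 /expT /= -[RHS]scalerAr -exprS mulr_natl -scaler_nat scalerA.
by rewrite factS natrM invfM mulrA divff ?R0 // mul1r.
Qed.

End HarmonicRegularization.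

(** * Polylogarithm coefficients and the shuffle product *)

Section WordSeries.
Variable R : realType.
Implicit Types (f g : nat -> R) (u v w : seq bool).
Local Notation tr := (mzv_trunc R).

(** The coefficients of f(z) z/(1-z). *)
Definition ps_sum f : nat -> R := fun n => \sum_(j < n) f j.

Lemma ps_mul_suml f g n : ps_mul (ps_sum f) g n = ps_sum (ps_mul f g) n.
Proof.
elim: n => [|n IHn]; first by rewrite /ps_mul /ps_sum big_ord1 !big_ord0 mul0r.
rewrite [RHS]/ps_sum big_ord_recr /= -/(ps_sum _ n) -IHn.
rewrite /ps_mul big_ord_recl {1}/ps_sum big_ord0 mul0r add0r -big_split /=.
by apply: eq_bigr => i _; rewrite /bump /= subSS /ps_sum big_ord_recr mulrDl.
Qed.

(* Coefficients of the polylogarithm attached to a word: reading the word from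
   the right, x is integration against dz/z and y against dz/(1-z). *)
Fixpoint wcoef w : nat -> R := fun m =>
  if w is b :: w' then (if b then ps_sum (wcoef w') else wcoef w') m / m%:R
  else ps1 R m.

Arguments wcoef : simpl never.

Lemma wcoef_cons b w m :
  wcoef (b :: w) m = (if b then ps_sum (wcoef w) else wcoef w) m / m%:R.
Proof. by []. Qed.

Lemma wcoef_cons0 b w : wcoef (b :: w) 0 = 0.
Proof. by rewrite wcoef_cons invr0 mulr0. Qed.

Lemma last_true_cons b w : last true (b :: w) -> last true w.
Proof. by case: w. Qed.

(** The hypothesis says that the word ends in y. It excludes the word x, for which division by m = 0
    would lose a constant term. *)
Lemma ps_theta_wcoef b w : last true (b :: w) ->
  ps_theta (wcoef (b :: w)) =1 if b then ps_sum (wcoef w) else wcoef w.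
Proof.
move=> bw [|m]; rewrite /ps_theta wcoef_cons; last first.
  by rewrite mulrC divfK ?pnatr_eq0.
rewrite mul0r; case: b bw => [_|]; first by rewrite /ps_sum big_ord0.
by case: w => // b w _; rewrite wcoef_cons0.
Qed.

Lemma ps_mul_theta_wcoef b w g n : last true (b :: w) ->
  ps_mul (ps_theta (wcoef (b :: w))) g n =
  (if b then ps_sum (ps_mul (wcoef w) g) else ps_mul (wcoef w) g) n.
Proof.
move=> bw; rewrite (eq_ps_mul (fun m _ => ps_theta_wcoef bw m) (fun m _ => erefl)).
by case: b bw => // _; rewrite ps_mul_suml.
Qed.

(** The Leibniz rule for [ps_theta] removes the first letter of one factor or the other, as the
    recursion of [shuffle] does. *)
Lemma wcoef_shuffle u v n : last true u -> last true v ->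
  ps_mul (wcoef u) (wcoef v) n = \sum_(w <- shuffle u v) wcoef w n.
Proof.
elim: u v n => [|a u IHu] v n; first by rewrite big_cons big_nil addr0 ps_mul1r.
move=> au; elim: v n => [|b v IHv] n bv.
  by rewrite big_cons big_nil addr0 ps_mulC ps_mul1r.
have step c (s : seq (seq bool)) m : m.+1%:R * (\sum_(w <- s) wcoef (c :: w) m.+1) =
    if c then ps_sum (fun i => \sum_(w <- s) wcoef w i) m.+1
    else \sum_(w <- s) wcoef w m.+1.
  rewrite mulr_sumr /ps_sum exchange_big /=.
  by case: c; apply: eq_bigr => w _; rewrite mulrC divfK ?pnatr_eq0.
rewrite [shuffle _ _]/= big_cat !big_map /=.
(* [ps_theta] does not see constant terms, so these are compared directly. *)
case: n => [|n].
  have sum0 c (s : seq (seq bool)) : \sum_(w <- s) wcoef (c :: w) 0 = 0.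
    by apply: big1 => w _; exact: wcoef_cons0.
  by rewrite /ps_mul big_ord1 wcoef_cons0 mul0r !sum0 addr0.
apply: (@mulfI _ n.+1%:R); first by rewrite pnatr_eq0.
rewrite -/(ps_theta _ n.+1) ps_thetaM [X in _ + X]ps_mulC !ps_mul_theta_wcoef //.
rewrite mulrDr !step; congr (_ + _).
  have IH m := IHu (b :: v) m (last_true_cons au) bv.
  by case: (a); [apply: eq_bigr => i _|]; rewrite IH.
have IH m := IHv m (last_true_cons bv).
by case: (b); [apply: eq_bigr => i _|]; rewrite ps_mulC IH.
Qed.

(** The value at 0 is [g 1], so that partial sums give back g and the empty index yields the
    constant series 1. *)
Definition increment g : nat -> R :=
  fun m => g m.+1 - (if m is 0%N then 0 else g m).

Lemma ps_sum_increment g n : ps_sum (increment g) n.+1 = g n.+1.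
Proof.
rewrite /ps_sum; elim: n => [|n IHn]; first by rewrite big_ord1 /increment subr0.
by rewrite big_ord_recr /= IHn /increment addrC subrK.
Qed.

Lemma increment_mzv_trunc a k m :
  increment (tr (a :: k)) m = (m%:R ^+ val a)^-1 * tr k m.
Proof.
rewrite /increment mzv_truncS; case: m => [|m]; last by rewrite addrC addKr.
by rewrite mzv_trunc0 add0r subr0.
Qed.

Lemma increment_mzv_trunc_nil m : increment (tr [::]) m = ps1 R m.
Proof. by rewrite /increment /ps1; case: m => [|m]; rewrite ?subr0 ?subrr. Qed.

Lemma wcoef_word k : wcoef (word_of_index k) =1 increment (tr k).
Proof.
elim: k => [|a k IHk] m; first by rewrite increment_mzv_trunc_nil.
rewrite word_of_index_cons increment_mzv_trunc.
have H n w : wcoef (nseq n false ++ w) m = (m%:R ^+ n)^-1 * wcoef w m.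
  elim: n => [|n IHn]; first by rewrite expr0 invr1 mul1r.
  by rewrite [nseq _ _ ++ _]/= wcoef_cons IHn exprS invfM mulrC mulrA.
rewrite H wcoef_cons /ps_sum; under eq_bigr do rewrite IHk.
rewrite -/(ps_sum _ m) -(prednK (valP a)) exprS invfM /=.
case: m {H} => [|m]; first by rewrite invr0 !mulr0 !mul0r.
by rewrite ps_sum_increment; ring.
Qed.

Lemma size_shuffle u v w : w \in shuffle u v -> size w = (size u + size v)%N.
Proof.
elim: u v w => [|a u IHu] v w; first by rewrite inE => /eqP ->.
elim: v w => [|b v IHv] w; first by rewrite inE addn0 => /eqP ->.
rewrite [shuffle _ _]/= mem_cat => /orP[] /mapP[m mI ->] /=.
  by rewrite (IHu _ _ mI).
by rewrite (IHv _ mI) addnS.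
Qed.

Lemma last_shuffle u v w : last true u -> last true v -> w \in shuffle u v ->
  last true w.
Proof.
elim: u v w => [|a u IHu] v w; first by rewrite inE => _ ? /eqP ->.
move=> au; elim: v w => [|b v IHv] w bv; first by rewrite inE => /eqP ->.
rewrite [shuffle _ _]/= mem_cat => /orP[] /mapP[m mI ->].
  have := size_shuffle mI; have := IHu _ _ (last_true_cons au) bv mI.
  by case: m {mI} => [_|//] /=; rewrite addnS.
have := @size_shuffle (a :: u) v m mI; have := IHv _ (last_true_cons bv) mI.
by case: m {mI} => [_|//] /=; rewrite addSn.
Qed.

Lemma last_word k : last true (word_of_index k).
Proof.
by elim: k => // a k IHk; rewrite word_of_index_cons last_cat.
Qed.

Lemma index_of_wordK w : last true w -> word_of_index (index_of_word w) = w.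
Proof.
case: w => // b w bw.
(* With letters x pending the remaining word cannot be empty, hence the default [false]. *)
suff H n v : last false v -> word_of_index (index_of_word_from n v) = nseq n false ++ v.
  exact: H.
elim: v n => // -[] v IHv n; rewrite [last _ _]/=.
  rewrite [index_of_word_from _ _]/= word_of_index_cons /=.
  by case: v IHv => // c v IHv cv; rewrite IHv.
move=> vl; have := IHv n.+1 vl; rewrite [index_of_word_from _ (_ :: _)]/= => ->.
by elim: n => //= n ->.
Qed.

Lemma increment_shuffle k l n :
  ps_mul (increment (tr k)) (increment (tr l)) n =
  \sum_(m <- index_shuffle k l) increment (tr m) n.
Proof.
rewrite (@eq_ps_mul _ _ (wcoef (word_of_index k)) _ (wcoef (word_of_index l))) => [|m _|m _].
- rewrite wcoef_shuffle ?last_word // big_map; apply: eq_big_seq => w wI.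
  by rewrite -wcoef_word index_of_wordK // (last_shuffle _ _ wI) ?last_word.
- by rewrite wcoef_word.
- by rewrite wcoef_word.
Qed.

Lemma index_shuffle_ones n :
  index_shuffle [:: pos1] (nseq n pos1) = nseq n.+1 (nseq n.+1 pos1).
Proof.
have wn m : word_of_index (nseq m pos1) = nseq m true.
  by elim: m => //= m IH; rewrite word_of_index_cons IH.
rewrite /index_shuffle (wn 1%N) wn.
have -> : shuffle (nseq 1 true) (nseq n true) = nseq n.+1 (nseq n.+1 true).
  elim: n => // n IHn.
  rewrite [RHS]/=; congr (_ :: _); have := congr1 (map (cons true)) IHn.
  by rewrite map_nseq.
by rewrite map_nseq -wn word_of_indexK.
Qed.

End WordSeries.

(** * The shuffle regularization *)

Section Polylogarithm.
Local Open Scope classical_set_scope.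
Variable R : realType.
Implicit Types (f g : nat -> R) (p q : {poly R}).
Local Notation tr := (mzv_trunc R).
Local Notation harm := (harm R).

(** Nonnegativity allows a squeeze: partial sums of the product are at most a b, and the one at 2n
    is at least the product of those at n. *)
Lemma cauchy_product (u v : nat -> R) (a b : R) :
  (forall n, 0 <= u n) -> (forall n, 0 <= v n) ->
  ps_sum u n @[n --> \oo] --> a -> ps_sum v n @[n --> \oo] --> b ->
  ps_sum (ps_mul u v) n @[n --> \oo] --> a * b.
Proof.
move=> u0 v0 ua vb.
have sum_ge0 w n : (forall n, 0 <= w n) -> 0 <= ps_sum w n :> R.
  by move=> w0; apply: sumr_ge0.
have sum_nd w : (forall n, 0 <= w n) -> nondecreasing_seq (ps_sum w : nat -> R).
  by move=> w0; apply/nondecreasing_seqP => n; rewrite /ps_sum big_ord_recr lerDl.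
have sum_le w c n : (forall n, 0 <= w n) -> ps_sum w n @[n --> \oo] --> c ->
    ps_sum w n <= c :> R.
  move=> w0 wc; rewrite -(cvg_lim _ wc) //.
  by apply: nondecreasing_cvgn_le; [exact: sum_nd | exact: cvgP wc].
have uv0 n : 0 <= ps_mul u v n by apply: sumr_ge0 => i _; rewrite mulr_ge0.
have uv_le n : ps_sum (ps_mul u v) n <= a * b.
  rewrite -ps_mul_suml.
  apply: le_trans (_ : ps_sum u n * ps_sum v n.+1 <= _); last first.
    by rewrite ler_pM ?sum_ge0 ?sum_le.
  rewrite [X in _ * X](reindex_inj rev_ord_inj) mulr_sumr.
  apply: ler_sum => i _; rewrite /= subSS ler_wpM2r //.
  by apply: sum_nd => //; rewrite -ltnS.
have uv_ge n : ps_sum u n * ps_sum v n <= ps_sum (ps_mul u v) (n + n).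
  rewrite -ps_mul_suml ps_mulC /ps_mul [X in _ * X]/ps_sum mulr_sumr.
  have le : (n <= (n + n).+1)%N by rewrite leqW // leq_addr.
  rewrite (big_ord_widen _ (fun i => ps_sum u n * v i) le) big_mkcond.
  apply: ler_sum => i _; rewrite mulrC; case: ifP => [ni|_].
    by rewrite ler_wpM2l // sum_nd //; lia.
  by rewrite mulr_ge0 ?sum_ge0.
have cv : cvgn (ps_sum (ps_mul u v)).
  apply: nondecreasing_is_cvgn; first exact: sum_nd.
  by exists (a * b) => _ [n _ <-].
suff -> : a * b = limn (ps_sum (ps_mul u v)) by [].
apply/eqP; rewrite eq_le; apply/andP; split; last first.
  by apply: limr_le => //; exists 0%N.
rewrite -(cvg_lim _ (cvgM ua vb)) //; apply: limr_le.
  exact: cvgP (cvgM ua vb).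
by exists 0%N => // n _; apply: le_trans (uv_ge n) (sum_le _ _ _ uv0 cv).
Qed.

(** The evaluation point z with 1 - z = 1/(M+1), where -log(1-z) has the size of [harm M]. *)
Definition ratio (M : nat) : R := M%:R / M.+1%:R.

Lemma ratioE M : 1 - ratio M = M.+1%:R^-1.
Proof.
have m0 : M.+1%:R != 0 :> R by rewrite pnatr_eq0.
rewrite /ratio -{1}(divff m0) -mulrBl -[X in X - _]natr1.
by rewrite addrAC subrr add0r mul1r.
Qed.

Lemma ratio_ge0 M : 0 <= ratio M. Proof. by rewrite divr_ge0. Qed.

Lemma ratio_le1 M : ratio M <= 1.
Proof. by rewrite -subr_ge0 ratioE invr_ge0. Qed.

Lemma geometric_le M n : (1 - ratio M) * \sum_(m < n) ratio M ^+ m <= 1.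
Proof.
have -> : (1 - ratio M) * \sum_(m < n) ratio M ^+ m = 1 - ratio M ^+ n.
  by rewrite -opprB mulNr -subrX1 opprB.
by rewrite gerBl exprn_ge0 ?ratio_ge0.
Qed.

(** * Abel summation *)

Definition abel g (M : nat) : nat -> R :=
  ps_sum (fun m => increment g m * ratio M ^+ m).

Lemma abelS g M n : abel g M n.+1 = g n.+1 * ratio M ^+ n +
  (1 - ratio M) * \sum_(m < n) g m.+1 * ratio M ^+ m.
Proof.
elim: n => [|n IHn].
  by rewrite /abel /ps_sum big_ord1 big_ord0 /increment !expr0 mulr0 subr0 addr0.
rewrite [LHS]/abel /ps_sum big_ord_recr /= -[X in X + _]/(abel g M n.+1) IHn.
by rewrite [in RHS]big_ord_recr /= /increment exprS; ring.
Qed.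

Lemma sum_if_ltn (F : nat -> R) n M :
  \sum_(m < n) (if (m < M)%N then F m else 0) = \sum_(m < minn n M) F m.
Proof.
elim: n => [|n IHn]; first by rewrite min0n !big_ord0.
rewrite big_ord_recr /= IHn; case: ltnP => nM.
  by rewrite (minn_idPl nM) big_ord_recr.
by rewrite (minn_idPr (leqW nM)) addr0.
Qed.

Lemma sum_if_ltn_le (F : nat -> R) n M : (forall m, 0 <= F m) ->
  \sum_(m < n) (if (m < M)%N then F m else 0) <= \sum_(m < M) F m.
Proof.
move=> F0; rewrite sum_if_ltn (big_ord_widen M F (geq_minr n M)) big_mkcond.
by apply: ler_sum => i _; case: ifP.
Qed.

(** The analogue of bounding the sum of m^-e by 2 M^(1-e). The cap e <= 1/4 gives the induction step
    (2m+1)(1 - e/m) >= 2m. *)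
Lemma sum_expR_harm e M : 0 < e <= 4^-1 ->
  \sum_(m < M) expR (- e * harm m.+1) <= 2 * M%:R * expR (- e * harm M).
Proof.
move=> /andP[e0 e4]; elim: M => [|M IHM]; first by rewrite big_ord0 mulr0 mul0r.
rewrite big_ord_recr /= (le_trans (lerD IHM (lexx _))) //.
rewrite harmS mulrDr expRD.
set W := expR _; have W0 : 0 <= W := expR_ge0 _.
case: M {IHM} @W W0 => [|M] W W0; first by rewrite invr0 !mulr0 mul0r expR0; lra.
have m0 : 0 < M.+1%:R :> R by rewrite ltr0n.
have m1 : 1 <= M.+1%:R :> R by rewrite ler1n.
have := expR_ge1Dx (- e * M.+1%:R^-1); rewrite -[M.+2%:R]natr1.
have : M.+1%:R * M.+1%:R^-1 = 1 :> R by rewrite divff ?gt_eqF.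
set x := M.+1%:R^-1; set m := M.+1%:R in m0 m1 *; move=> mx h.
suff h' : 2 * m <= (2 * m + 1) * expR (- e * x).
  by have := ler_wpM2l W0 h'; lra.
have x0 : 0 <= x by rewrite invr_ge0 ltW.
have x1 : x <= 1 by rewrite invf_le1.
have ex : e * x <= e by rewrite ler_piMr // ltW.
apply: le_trans (_ : (2 * m + 1) * (1 + - e * x) <= _).
  rewrite [leRHS](_ : _ = 2 * m + 1 - 2 * e * (m * x) - e * x); last by ring.
  by rewrite mx; lra.
by rewrite ler_wpM2l //; lra.
Qed.

(** After summation by parts the sum is cut at M. Terms below are averaged with weight 1/(M+1);
    those above are bounded by their size at M, with total geometric weight at most 1. *)
Lemma negl_abel g (G : nat -> R) : negl g -> (forall M, abel g M n @[n --> \oo] --> G M) ->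
  negl G.
Proof.
move=> [e /andP[e0 e4] [C gC]] gG; have C0 := bound_ge0 (gC _).
exists e; first by rewrite e0.
exists (4 * C) => M; pose W N := expR (- e * harm N).
have W0 N : 0 <= W N := expR_ge0 _.
have Wle N : (M <= N)%N -> W N <= W M.
  by move=> MN; rewrite ler_expR !mulNr lerN2 ler_wpM2l ?harm_nondecreasing ?ltW.
have z0 := ratio_ge0 M; have z1 := ratio_le1 M.
have bound n : (M <= n)%N -> `|abel g M n.+1| <= 4 * C * W M.
  move=> Mn; rewrite abelS (le_trans (ler_normD _ _)) //.
  (* The 4 is made of 1 from the boundary term, 2 from m < M and 1 from m >= M. *)
  rewrite (_ : 4 * C * W M = C * W M + 3 * C * W M); last by ring.
  apply: lerD.
    rewrite normrM -[leRHS]mulr1 ler_pM // ?(le_trans (gC _)) //.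
      by rewrite ler_wpM2l // Wle // leqW.
    by rewrite ger0_norm ?exprn_ge0 // exprn_ile1.
  rewrite normrM (ger0_norm (_ : 0 <= 1 - ratio M)) ?subr_ge0 //.
  apply: le_trans (_ : (1 - ratio M) * (C * (\sum_(m < M) W m.+1) +
      C * W M * \sum_(m < n) ratio M ^+ m) <= _).
    rewrite ler_wpM2l ?subr_ge0 // (le_trans (ler_norm_sum _ _ _)) //.
    rewrite (le_trans _ (lerD (ler_wpM2l C0 (@sum_if_ltn_le (fun m => W m.+1) n M _)) (lexx _))) //.
    rewrite !mulr_sumr -big_split /=; apply: ler_sum => m _.
    rewrite normrM (ger0_norm (exprn_ge0 _ z0)).
    apply: le_trans (_ : C * W m.+1 * ratio M ^+ m <= _).
      by rewrite ler_wpM2r ?exprn_ge0 ?gC.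
    case: ltnP => mM.
      rewrite -[leLHS]addr0 lerD ?mulr_ge0 ?exprn_ge0 //.
      by rewrite ler_piMr ?mulr_ge0 ?exprn_ile1.
    rewrite mulr0 add0r ler_wpM2r ?exprn_ge0 // ler_wpM2l //.
    by rewrite Wle // leqW.
  have h1 := geometric_le M n; have h2 := @sum_expR_harm e M; rewrite e0 e4 in h2.
  have {}h2 := h2 isT; rewrite -/(W M) in h2.
  rewrite mulrDr mulrCA [X in _ + X]mulrCA.
  have CW : 0 <= C * W M by rewrite mulr_ge0.
  have h3 : (1 - ratio M) * \sum_(m < M) W m.+1 <= 2 * W M.
    apply: le_trans (ler_wpM2l _ h2) _; first by rewrite subr_ge0.
    by rewrite ratioE ler_pdivrMl ?ltr0n // -natr1; have := W0 M; lra.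
  have := ler_wpM2l C0 h3; have := ler_wpM2l CW h1; lra.
have cvn : `|abel g M n| @[n --> \oo] --> `|G M| by apply: cvg_norm; exact: gG.
rewrite -(cvg_lim _ cvn) //.
apply: limr_le; first exact: cvgP cvn.
by exists M.+1 => // -[|n] //= Mn; apply: bound.
Qed.

(** * Multiple polylogarithms at the points M/(M+1) *)

Lemma increment_ge0 k m : 0 <= increment (tr k) m.
Proof.
case: k => [|a k]; first by rewrite increment_mzv_trunc_nil /ps1 ler0n.
by rewrite increment_mzv_trunc mulr_ge0 ?mzv_trunc_ge0 // invr_ge0 exprn_ge0.
Qed.

Lemma increment_bounded k : exists K, forall m, increment (tr k) m <= K.
Proof.
case: k => [|a k].
  by exists 1 => m; rewrite increment_mzv_trunc_nil /ps1 lern1 leq_b1.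
have [C kC] := mzv_trunc_subexp k (@ltr01 R); have C0 := bound_ge0 (kC 0%N).
exists (C * expR 1) => m; rewrite increment_mzv_trunc.
case: m => [|m].
  by rewrite expr0n gtn_eqF ?(valP a) //= invr0 mul0r mulr_ge0 ?expR_ge0.
have m0 : 0 < m.+1%:R :> R by rewrite ltr0n.
rewrite mulrC ler_pdivrMr ?exprn_gt0 //.
have := kC m.+1; rewrite ger0_norm ?mzv_trunc_ge0 // mul1r => /le_trans; apply.
rewrite -mulrA ler_wpM2l // (le_trans (expR_harm_le _ _)) //.
by rewrite ler_wpM2l ?expR_ge0 // ler_eXnr ?(valP a) // ler1n.
Qed.

Lemma abel_nondecreasing k M : nondecreasing_seq (abel (tr k) M).
Proof.
apply/nondecreasing_seqP => n; rewrite /abel /ps_sum big_ord_recr lerDl.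
by rewrite mulr_ge0 ?increment_ge0 ?exprn_ge0 ?ratio_ge0.
Qed.

(** Convergent for every index, admissible or not, because the increments are bounded and [ratio M]
    is below 1. *)
Definition polylog k (M : nat) : R := limn (abel (tr k) M).

Lemma abel_cvg k M : abel (tr k) M n @[n --> \oo] --> polylog k M.
Proof.
suff : cvgn (abel (tr k) M) by [].
apply: nondecreasing_is_cvgn; first exact: abel_nondecreasing.
have [K kK] := increment_bounded k.
have K0 : 0 <= K := le_trans (increment_ge0 k 0) (kK 0%N).
exists (K * M.+1%:R) => _ [n _ <-].
apply: le_trans (_ : K * \sum_(m < n) ratio M ^+ m <= _).
  rewrite mulr_sumr; apply: ler_sum => m _.
  by rewrite ler_wpM2r // exprn_ge0 // ratio_ge0.
have := geometric_le M n; rewrite ratioE ler_pdivrMl ?ltr0n // mulr1.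
exact: ler_wpM2l.
Qed.

Lemma polylog_shuffle k l M :
  polylog k M * polylog l M = \sum_(m <- index_shuffle k l) polylog m M.
Proof.
have pos j n : 0 <= increment (tr j) n * ratio M ^+ n.
  by rewrite mulr_ge0 ?increment_ge0 ?exprn_ge0 ?ratio_ge0.
have := cauchy_product (pos k) (pos l) (@abel_cvg k M) (@abel_cvg l M).
move/(cvg_lim (@Rhausdorff R)) => <-; apply/cvg_lim => //.
rewrite (_ : ps_sum _ = fun n => \sum_(m <- index_shuffle k l) abel (tr m) M n).
  elim: (index_shuffle k l) => [|m s IHs].
    by under eq_fun do rewrite big_nil; rewrite big_nil; apply: cvg_cst.
  under eq_fun do rewrite big_cons.
  by rewrite big_cons; apply: cvgD => //; exact: abel_cvg.
apply/funext => n; rewrite /abel /ps_sum exchange_big /=.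
apply: eq_bigr => i _; rewrite -mulr_suml -increment_shuffle /ps_mul mulr_suml.
apply: eq_bigr => j _; rewrite mulrACA -exprD subnKC // -ltnS ltn_ord //.
Qed.

Lemma polylog_nil M : polylog [::] M = 1.
Proof.
apply/cvg_lim => //; apply: cvg_near_cst.
exists 1%N => // -[|n] // _; rewrite /abel /ps_sum big_ord_recl expr0 mulr1.
rewrite increment_mzv_trunc_nil big1 ?addr0 // => i _.
by rewrite increment_mzv_trunc_nil mul0r.
Qed.

Lemma polylog_ones n M :
  polylog (nseq n pos1) M = (n`!%:R)^-1 * polylog [:: pos1] M ^+ n.
Proof.
elim: n => [|n IHn]; first by rewrite polylog_nil fact0 invr1 mulr1.
have := polylog_shuffle [:: pos1] (nseq n pos1) M.
rewrite index_shuffle_ones big_nseq iter_addr_0 IHn => h.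
apply: (@mulfI _ n.+1%:R); first by rewrite pnatr_eq0.
rewrite [LHS]mulr_natl -h factS natrM invfM exprS !mulrA divff ?pnatr_eq0 //.
by rewrite mul1r [_ * _^-1]mulrC.
Qed.

Lemma harmE N : harm N = \sum_(m < N) m%:R^-1.
Proof.
elim: N => [|N IHN]; first by rewrite big_ord0 /harm mzv_trunc0.
by rewrite harmS big_ord_recr /= IHN.
Qed.

Lemma harm_like_polylog : harm_like (polylog [:: pos1]).
Proof.
move=> M; have z0 := ratio_ge0 M; have z1 := ratio_le1 M.
have cv := @abel_cvg [:: pos1] M.
have incE m : increment (tr [:: pos1]) m = m%:R^-1.
  by rewrite increment_mzv_trunc expr1 mulr1.
apply/andP; split.
  rewrite -(cvg_lim _ cv) //.
  apply: le_trans (nondecreasing_cvgn_le (@abel_nondecreasing _ _) (cvgP _ cv) M).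
  rewrite lerBlDr harmE -lerBlDl -sumrB.
  apply: le_trans (_ : \sum_(m < M) M.+1%:R^-1 <= _); last first.
    by rewrite sumr_const card_ord -[leLHS]mulr_natl ler_pdivrMr ?ltr0n // mul1r ler_nat.
  apply: ler_sum => m _; rewrite incE.
  (* Only the first M terms are kept. Bernoulli's inequality costs 1/(M+1) in each of them, at most
     1 in all. *)
  have bern : 1 - m%:R * (1 - ratio M) <= ratio M ^+ m.
    elim: (m : nat) => [|j IHj]; first by rewrite mul0r subr0.
    have j0 := mulr_ge0 (ler0n R j) (sqr_ge0 (1 - ratio M)).
    rewrite exprS -natr1; have := ler_wpM2l z0 IHj; rewrite expr2 in j0; lra.
  rewrite -ratioE; case: (posnP m) => [->|m0].
    by rewrite invr0 mul0r subrr subr_ge0.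
  have i0 : 0 <= m%:R^-1 :> R by rewrite invr_ge0.
  have := ler_wpM2l i0 bern; rewrite mulrBr mulr1 mulKf; first lra.
  by rewrite pnatr_eq0 -lt0n.
rewrite -(cvg_lim _ cv) //; apply: limr_le; first exact: cvgP cv.
exists 0%N => // n _ /=.
(* Terms with m <= M add up to at most [harm M.+1], and for the others 1/m <= 1 - z. Each part
   exceeds its share of [harm M] by at most 1. *)
apply: le_trans (_ : \sum_(m < M.+1) m%:R^-1 +
    (1 - ratio M) * \sum_(m < n) ratio M ^+ m <= _); last first.
  rewrite -harmE harmS; have := geometric_le M n.
  have : M%:R^-1 <= 1 :> R.
    by case: (M) => [|j]; rewrite ?invr0 // invf_le1 ?ltr0n // ler1n.
  lra.
have i0 (m : nat) : 0 <= m%:R^-1 :> R by rewrite invr_ge0.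
rewrite (le_trans _ (lerD (sum_if_ltn_le n M.+1 i0) (lexx _))) //.
rewrite mulr_sumr -big_split; apply: ler_sum => m _ /=; rewrite incE.
case: ltnP => mM.
  by rewrite -[leLHS]addr0 lerD ?mulr_ge0 ?exprn_ge0 ?subr_ge0 // ler_piMr ?exprn_ile1.
rewrite add0r ler_wpM2r ?exprn_ge0 // ratioE lef_pV2 ?posrE ?ltr0n ?ler_nat //.
exact: leq_ltn_trans mM.
Qed.

(** * Transfer from truncated sums to polylogarithms *)

Local Notation L := (polylog [:: pos1]).

(* [g ~ p(H_N)] implies [sum_m (g (m+1) - g m) z^m ~ q(L(z))]. *)
Definition transfers p q := exists g G, [/\ asymp harm g p,
  forall M, abel g M n @[n --> \oo] --> G M & asymp L G q].

Lemma abelD f g M : abel (fun N => f N + g N) M =1 fun n => abel f M n + abel g M n.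
Proof.
move=> n; rewrite /abel /ps_sum -big_split; apply: eq_bigr => -[[|m] ?] _ /=;
by rewrite /increment; ring.
Qed.

Lemma abelZ c g M : abel (fun N => c * g N) M =1 fun n => c * abel g M n.
Proof.
move=> n; rewrite /abel /ps_sum mulr_sumr; apply: eq_bigr => -[[|m] ?] _ /=;
by rewrite /increment; ring.
Qed.

Lemma transfersD p q p' q' : transfers p q -> transfers p' q' ->
  transfers (p + p') (q + q').
Proof.
move=> [g [G [gp gG Gq]]] [f [F [fp fF Fq]]].
exists (fun N => g N + f N), (fun N => G N + F N); split.
- exact: asympD.
- by move=> M; under eq_fun do rewrite abelD; apply: cvgD.
- exact: asympD.
Qed.

Lemma transfersZ c p q : transfers p q -> transfers (c *: p) (c *: q).
Proof.
move=> [g [G [gp gG Gq]]]; exists (fun N => c * g N), (fun N => c * G N); split.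
- exact: asympZ.
- by move=> M; under eq_fun do rewrite abelZ; apply: cvgM => //; exact: cvg_cst.
- exact: asympZ.
Qed.

Lemma transfers_ones n : transfers (zeta_star R (nseq n pos1)) (expT R n).
Proof.
exists (tr (nseq n pos1)), (polylog (nseq n pos1)); split.
- exact: zeta_starP.
- by move=> M; exact: abel_cvg.
by apply: eq_negl (negl0 R) => M; rewrite hornerZ hornerXn polylog_ones subrr.
Qed.

Lemma transfers_sum n (P Q : 'I_n -> {poly R}) :
  (forall i, transfers (P i) (Q i)) -> transfers (\sum_i P i) (\sum_i Q i).
Proof.
move=> PQ; apply: (big_ind2 transfers) => [||i _]; [|exact: transfersD|exact: PQ].
by have := transfersZ 0 (transfers_ones 0); rewrite !scale0r.
Qed.

Definition zeta_sh k : {poly R} := exp_op (ps_exp (exp_coeff R)) (zeta_star R k).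

(** By [zeta_star_ones], T^m/m! is a combination of the polynomials of (1,...,1) with the
    coefficients of A. Each of these transfers to some T^j/j!, and linearity gives A(d/dT). *)
Lemma transfers_exp_op p : transfers p (exp_op (ps_exp (exp_coeff R)) p).
Proof.
have R0 m : (m%:R == 0 :> R) = (m == 0%N) by rewrite pnatr_eq0.
rewrite {1}(polyC_expT R0 p) /exp_op; apply: transfers_sum => m.
rewrite -zeta_star_ones; apply: transfersZ; apply: transfers_sum => i.
by rewrite !mul_polyC; apply: transfersZ; exact: transfers_ones.
Qed.

(** A sequence realizing the transfer of [zeta_star R k] differs negligibly from the truncated sums,
    and Abel summation preserves this. *)
Lemma zeta_shP k : asymp L (polylog k) (zeta_sh k).
Proof.
have [g [G [gp gG Gq]]] := transfers_exp_op (zeta_star R k).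
have kg : negl (fun N => tr k N + -1 * g N).
  by apply: eq_negl (neglB (zeta_starP R k) gp) => N; ring.
have kG : negl (fun M => polylog k M + -1 * G M).
  apply: negl_abel kg _ => M; under eq_fun do rewrite abelD abelZ.
  by apply: cvgD; [exact: abel_cvg | apply: cvgM => //; exact: cvg_cst].
by apply: eq_negl (neglD kG Gq) => N; ring.
Qed.

Lemma zeta_sh_regularization : is_regularization Shuffle zeta_sh.
Proof.
have [star_adm _ _] := zeta_star_regularization R.
(* At admissible indices the harmonic polynomial is constant, and only A_0 = 1 acts. *)
split=> [k kadm||k l].
- rewrite /zeta_sh star_adm // (@exp_opE _ _ _ _ 1) ?size_polyC_leq1 //.
    by rewrite big_ord1 ps_exp0 scale1r.
  by move=> m; rewrite pnatr_eq0.
- exact: asymp_uniq harm_like_polylog (zeta_shP _) (asymp_id _).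
have kl := asympM harm_like_polylog (zeta_shP k) (zeta_shP l).
apply: asymp_uniq harm_like_polylog kl _.
apply: eq_asymp (asymp_sum (fun m _ => zeta_shP m)) => M.
by rewrite polylog_shuffle.
Qed.

End Polylogarithm.

(** * The two-variable series *)

Section NcSeriesTheory.
Variable A : comNzRingType.
Implicit Types (f g h : ncseries A) (v : seq posnat).

Lemma ncs_mul_nil f g : ncs_mul f g [::] = f [::] * g [::].
Proof. by rewrite /ncs_mul big_ord1. Qed.

Lemma ncs_mul_cons f g a v :
  ncs_mul f g (a :: v) = f [::] * g (a :: v) + ncs_mul (fun w => f (a :: w)) g v.
Proof. by rewrite /ncs_mul big_ord_recl. Qed.

Lemma ncs_mulDl f1 f2 g v :
  ncs_mul (fun w => f1 w + f2 w) g v = ncs_mul f1 g v + ncs_mul f2 g v.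
Proof. by rewrite /ncs_mul -big_split; apply: eq_bigr => i _; rewrite mulrDl. Qed.

Lemma ncs_mulZl c f g v : ncs_mul (fun w => c * f w) g v = c * ncs_mul f g v.
Proof. by rewrite /ncs_mul mulr_sumr; apply: eq_bigr => i _; rewrite mulrA. Qed.

Lemma ncs_mulA f g h v : ncs_mul (ncs_mul f g) h v = ncs_mul f (ncs_mul g h) v.
Proof.
elim: v f => [|a v IHv] f; first by rewrite !ncs_mul_nil mulrA.
rewrite !ncs_mul_cons ncs_mul_nil -IHv.
have -> : (fun w => ncs_mul f g (a :: w)) =
    fun w => f [::] * g (a :: w) + ncs_mul (fun w => f (a :: w)) g w.
  by apply/funext => w; rewrite ncs_mul_cons.
by rewrite ncs_mulDl ncs_mulZl mulrDr mulrA addrA.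
Qed.

Lemma ncs_mul_rev f g v :
  ncs_mul f g v = ncs_mul (g \o rev) (f \o rev) (rev v).
Proof.
rewrite /ncs_mul size_rev (reindex_inj rev_ord_inj); apply: eq_bigr => i _ /=.
have iv := leq_ord i.
by rewrite subSS take_rev drop_rev !revK mulrC.
Qed.

(** Deleting ones becomes multiplication by X_1, so associativity can move them across a cut. *)
Lemma ncs_mul_X1l g v : ncs_mul (ncsX A pos1) g v = drop_pos1 g v.
Proof.
case: v => [|a v]; first by rewrite ncs_mul_nil mul0r.
rewrite ncs_mul_cons mul0r add0r /ncsX /drop_pos1 /ncs_mul big_ord_recl /=.
rewrite take0 drop0 eqseq_cons eqxx andbT big1 ?addr0 => [|i _].
  by case: eqP; rewrite ?mul1r ?mul0r.
rewrite eqseq_cons [take _ _ == _](_ : _ = false) ?andbF ?mul0r //.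
by case: v i => [[]|].
Qed.

Lemma ncs_mul_X1r f v : ncs_mul f (ncsX A pos1) v = drop_pos1 (f \o rev) (rev v).
Proof.
rewrite ncs_mul_rev -ncs_mul_X1l; congr (ncs_mul _ _ _); apply/funext => w.
by rewrite /ncsX /= -[_ == [:: pos1]](inj_eq (can_inj revK)) revK.
Qed.

End NcSeriesTheory.

Lemma triangular_sum (V : zmodType) (h : nat -> nat -> V) N :
  (forall a b, (N <= a + b)%N -> h a b = 0) ->
  \sum_(a < N) \sum_(b < N) h a b = \sum_(n < N) \sum_(a < n.+1) h a (n - a)%N.
Proof.
move=> h0.
under [RHS]eq_bigr => n _ do
  rewrite (big_ord_widen N (fun a => h a (n - a)%N)) ?ltn_ord // big_mkcond.
rewrite [RHS]exchange_big /=; apply: eq_bigr => a _.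
rewrite -[LHS](big_mkord xpredT (h a)) -[RHS](big_mkord xpredT
  (fun n => if (a < n.+1)%N then h a (n - a)%N else 0)).
have aN := ltnW (ltn_ord a).
rewrite (big_cat_nat (leq0n (N - a)) (leq_subr a N)) /=.
rewrite [X in _ + X]big1_seq ?addr0 => [|b]; last first.
  by rewrite mem_index_iota => /andP[_ ?]; apply: h0; lia.
rewrite [RHS](big_cat_nat (leq0n a) aN) /= [X in _ = X + _]big1_seq; last first.
  by move=> n; rewrite mem_index_iota => /andP[_ ?]; case: ifP => //; lia.
rewrite add0r -[X in index_iota X N]add0n big_addn.
by apply: eq_bigr => b _; rewrite ltnS leq_addl addnK.
Qed.

(** * The identity for A_{x,y} and the two-variable polynomials *)

Section RatXY.
Variable R : realType.
Local Notation K := (ratxy R).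
Local Notation x := (ratx R).
Local Notation y := (raty R).
Local Notation C := (@ratxyC R).

HB.instance Definition _ := GRing.RMorphism.copy (@ratxyC R)
  (@tofrac {poly {poly R}} \o (@polyC {poly R} \o @polyC R)).

Lemma ratxyC0 : C 0 = 0. Proof. exact: rmorph0. Qed.

Lemma xy_neq0 : x + y != 0.
Proof.
rewrite /ratx /raty -rmorphD tofrac_eq0 addrC.
by rewrite -size_poly_eq0 size_XaddC.
Qed.

Lemma ps_mul_dilate (F : comNzRingType) (s : F) (f g : nat -> F) n :
  ps_mul (fun i => f i * s ^+ i) (fun i => g i * s ^+ i) n = ps_mul f g n * s ^+ n.
Proof.
rewrite /ps_mul mulr_suml; apply: eq_bigr => i _.
by rewrite mulrACA -exprD subnKC // -ltnS.
Qed.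

Local Notation A := (ps_exp (exp_coeff R)).

(** A_{x,y}((x+y)u) = A(xu) A(yu), by equality of logarithmic derivatives: the dilation by x + y
    cancels the denominators. *)
Lemma Axy_mul n :
  Axy R n * (x + y) ^+ n =
  ps_mul (fun i => C (A i) * x ^+ i) (fun i => C (A i) * y ^+ i) n.
Proof.
have R0 m : (m%:R == 0 :> R) = (m == 0%N) by rewrite pnatr_eq0.
have K0 := ratxy_natr_eq0 R.
pose d (s : K) i := C (ps_theta (exp_coeff R) i) * s ^+ i.
have dE s j : ps_theta (fun i => C (A i) * s ^+ i) j =
    ps_mul (d s) (fun i => C (A i) * s ^+ i) j.
  rewrite ps_mul_dilate /ps_theta mulrA; congr (_ * _).
  rewrite -(rmorph_nat C) -rmorphM -/(ps_theta _ j) ps_theta_exp // /ps_mul.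
  by rewrite rmorph_sum; apply: eq_bigr => i _; rewrite rmorphM.
pose g i := d x i + d y i.
move: n; apply: (@ps_ode_uniq K g (fun i => Axy R i * (x + y) ^+ i)
  (ps_mul (fun i => C (A i) * x ^+ i) (fun i => C (A i) * y ^+ i))) => //.
- by rewrite /g /d /ps_theta mul0r ratxyC0 !mul0r addr0.
- by rewrite /Axy ps_exp0 /ps_mul big_ord1 !ps_exp0 rmorph1 !expr0 !mulr1.
- move=> n; rewrite /ps_theta mulrA /Axy -/(ps_theta _ n) ps_theta_exp //.
  rewrite -ps_mul_dilate; apply: eq_ps_mul => // i _.
  rewrite /g /d /ps_theta /exp_coeff -mulrDr; case: ltnP => i2.
    by rewrite !mulr0 ratxyC0 !mul0r.
  have s0 := expf_neq0 i xy_neq0.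
  have -> : C (i%:R * ((-1) ^+ i / i%:R * mzv R [:: posnat_succ i.-1])) =
      i%:R * ((-1) ^+ i / i%:R * C (mzv R [:: posnat_succ i.-1])).
    by rewrite !rmorphM fmorphV !rmorph_nat rmorphXn rmorphN1.
  by rewrite -!mulrA mulVf // mulr1.
move=> n; rewrite ps_thetaM.
rewrite (eq_ps_mul (fun m _ => dE x m) (fun m _ => erefl)) -ps_mulA.
rewrite (eq_ps_mul (fun m _ => erefl) (fun m _ => dE y m)).
rewrite (ps_mulA _ (d y)) (eq_ps_mul (fun m _ => ps_mulC _ (d y) m) (fun m _ => erefl)).
by rewrite -(ps_mulA (d y)) -ps_mulDl.
Qed.

Local Notation Z := (zeta_regxy R Harmonic).
Local Notation X1 := (ncsX {poly K} pos1).

Lemma zeta_regxy_shuffle k n : (size (Z k) <= n)%N ->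
  zeta_regxy R Shuffle k = \sum_(j < n) C (A j) *: (Z k)^`(j).
Proof.
rewrite /zeta_regxy (zeta_regP (zeta_star_regularization R)).
rewrite (zeta_regP (zeta_sh_regularization R)) size_map_poly => kn.
rewrite /zeta_sh (exp_opE _ _ kn) => [|m]; last by rewrite pnatr_eq0.
rewrite rmorph_sum; apply: eq_bigr => j _.
by rewrite /= map_polyZ derivn_map.
Qed.

Lemma deriv_zeta_regxy k : (Z k)^`() = drop_pos1 Z k.
Proof.
rewrite /zeta_regxy (zeta_regP (zeta_star_regularization R)) deriv_map.
rewrite (deriv_regularization (zeta_star_regularization R)) /drop_pos1.
by case: k => [|a k]; rewrite ?rmorph0 //; case: eqP => // _; rewrite rmorph0.
Qed.

(** The harmonic generating series with X_a replaced by c^a X_a. *)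
Definition scaled (c : K) : ncseries {poly K} := fun k => c ^+ weight k *: Z k.

Lemma weight_rev k : weight (rev k) = weight k.
Proof. by rewrite /weight big_rev. Qed.

(** The sum over cuts is a product of two series, the first with reversed words. *)
Lemma zeta_xyE k : zeta_xy R Harmonic k = ncs_mul (scaled x \o rev) (scaled y) k.
Proof.
apply: eq_bigr => i _; rewrite /scaled /= weight_rev.
by rewrite -scalerAl -scalerAr scalerA.
Qed.

Lemma deriv_scaled c k : (scaled c k)^`() = c *: drop_pos1 (scaled c) k.
Proof.
rewrite /scaled derivZ deriv_zeta_regxy; case: k => [|a k]; rewrite /= ?scaler0 //.
case: eqP => [->|]; rewrite ?scaler0 // scalerA -exprS.
by rewrite /weight big_cons.
Qed.

Definition tail_ones n : ncseries {poly K} := iter n (ncs_mul X1) (scaled y).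
Definition head_ones n : ncseries {poly K} :=
  iter n (fun f => ncs_mul f X1) (scaled x \o rev).

Lemma drop_pos1Z (c : K) (f : ncseries {poly K}) k :
  drop_pos1 (fun v => c *: f v) k = c *: drop_pos1 f k.
Proof. by case: k => [|a k] /=; rewrite ?scaler0 //; case: eqP; rewrite ?scaler0. Qed.

Lemma deriv_drop_pos1 (f : ncseries {poly K}) k :
  (drop_pos1 f k)^`() = drop_pos1 (fun v => (f v)^`()) k.
Proof. by case: k => [|a k] /=; rewrite ?deriv0 //; case: eqP; rewrite ?deriv0. Qed.

Lemma deriv_tail_ones n v : (tail_ones n v)^`() = y *: tail_ones n.+1 v.
Proof.
elim: n v => [|n IHn] v; first by rewrite deriv_scaled /tail_ones /= ncs_mul_X1l.
rewrite /tail_ones !iterS -/(tail_ones n) -/(tail_ones n.+1) !ncs_mul_X1l.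
by rewrite deriv_drop_pos1 (funext IHn) drop_pos1Z.
Qed.

Lemma deriv_head_ones n v : (head_ones n v)^`() = x *: head_ones n.+1 v.
Proof.
elim: n v => [|n IHn] v.
  rewrite /head_ones /= deriv_scaled ncs_mul_X1r.
  by congr (_ *: drop_pos1 _ _); apply/funext => w; rewrite /= revK.
rewrite /head_ones !iterS -/(head_ones n) -/(head_ones n.+1) !ncs_mul_X1r.
rewrite deriv_drop_pos1 -drop_pos1Z; congr drop_pos1; apply/funext => w.
exact: IHn.
Qed.

Lemma derivn_tail_ones n v : (scaled y v)^`(n) = y ^+ n *: tail_ones n v.
Proof.
elim: n => [|n IHn]; first by rewrite expr0 scale1r.
by rewrite derivnS IHn derivZ deriv_tail_ones scalerA -exprSr.
Qed.

Lemma derivn_head_ones n v : (scaled x (rev v))^`(n) = x ^+ n *: head_ones n v.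
Proof.
elim: n => [|n IHn]; first by rewrite expr0 scale1r.
by rewrite derivnS IHn derivZ deriv_head_ones scalerA -exprSr.
Qed.

(** The coefficient at k sums over all ways of removing n consecutive ones at the cut. *)
Definition middle_ones n : ncseries {poly K} := ncs_mul (scaled x \o rev) (tail_ones n).

Lemma middle_onesE a b k :
  ncs_mul (head_ones a) (tail_ones b) k = middle_ones (a + b) k.
Proof.
elim: a b => [//|a IHa] b.
rewrite /head_ones iterS -/(head_ones a) ncs_mulA.
by rewrite -[ncs_mul X1 _]/(tail_ones b.+1) IHa addnS.
Qed.

Lemma tail_ones_large n v : (size v < n)%N -> tail_ones n v = 0.
Proof.
elim: n v => // n IHn v vn; rewrite /tail_ones iterS -/(tail_ones n) ncs_mul_X1l.
by case: v vn => [|a v] //= vn; case: eqP => // _; apply: IHn.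
Qed.

Lemma middle_ones_large n k : (size k < n)%N -> middle_ones n k = 0.
Proof.
move=> kn; rewrite /middle_ones /ncs_mul big1 // => i _.
by rewrite tail_ones_large ?mulr0 // size_drop (leq_ltn_trans (leq_subr _ _)).
Qed.

Lemma deriv_ncs_mul (f g : ncseries {poly K}) k : (ncs_mul f g k)^`() =
  ncs_mul (fun v => (f v)^`()) g k + ncs_mul f (fun v => (g v)^`()) k.
Proof.
rewrite /ncs_mul (big_morph _ (@derivD K) (@deriv0 K)) -big_split.
by apply: eq_bigr => i _; rewrite derivM.
Qed.

(** The left factor contributes x and the right one y, and both create the same X_1 at the cut. *)
Lemma deriv_middle_ones n k :
  (middle_ones n k)^`() = (x + y) *: middle_ones n.+1 k.
Proof.
rewrite [in LHS]/middle_ones deriv_ncs_mul scalerDl; congr (_ + _).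
  rewrite -[middle_ones n.+1 k]/(middle_ones (1 + n) k) -middle_onesE.
  rewrite /ncs_mul scaler_sumr; apply: eq_bigr => i _.
  by rewrite scalerAl -deriv_head_ones.
rewrite /middle_ones /ncs_mul scaler_sumr; apply: eq_bigr => i _.
by rewrite scalerAr -deriv_tail_ones.
Qed.

Lemma derivn_zeta_xy n k :
  (zeta_xy R Harmonic k)^`(n) = (x + y) ^+ n *: middle_ones n k.
Proof.
elim: n => [|n IHn]; first by rewrite zeta_xyE expr0 scale1r.
by rewrite derivnS IHn derivZ deriv_middle_ones scalerA -exprSr.
Qed.

Lemma zeta_xy_shuffle k : zeta_xy R Shuffle k = rho (zeta_xy R Harmonic k).
Proof.
(* N bounds all degrees involved and also exceeds the length of k, so that [middle_ones] vanishes
   for a + b >= N. *)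
pose n0 := (\max_(i < (size k).+1)
  maxn (size (Z (rev (take i k)))) (size (Z (drop i k))))%N.
pose N := maxn (size k).+1 (maxn n0 (size (zeta_xy R Harmonic k))).
have kN : (size k < N)%N by rewrite leq_maxl.
have n0N : (n0 <= N)%N by rewrite !leq_max leqnn orbT.
have zN : (size (zeta_xy R Harmonic k) <= N)%N by rewrite !leq_max leqnn !orbT.
have sum_scaled c v : (size (Z v) <= N)%N -> c ^+ weight v *: zeta_regxy R Shuffle v =
    \sum_(j < N) C (A j) *: (scaled c v)^`(j).
  move=> vN; rewrite (zeta_regxy_shuffle vN) scaler_sumr; apply: eq_bigr => j _.
  by rewrite /scaled derivnZ !scalerA mulrC.
(* [rho] unfolds to A_{x,y}(d/dT). The powers of x + y from the derivatives turn its coefficients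
   into those of A(xu) A(yu). *)
rewrite -[rho _]/(exp_op (Axy R) _) (exp_opE (@ratxy_natr_eq0 R) _ zN).
under eq_bigr do rewrite derivn_zeta_xy scalerA Axy_mul /ps_mul scaler_suml.
pose h a b := (C (A a) * x ^+ a * (C (A b) * y ^+ b)) *: middle_ones (a + b) k.
have hE (n : 'I_N) : \sum_(a < n.+1)
    (C (A a) * x ^+ a * (C (A (n - a)%N) * y ^+ (n - a))) *: middle_ones n k =
    \sum_(a < n.+1) h a (n - a)%N.
  by apply: eq_bigr => a _; rewrite /h subnKC // -ltnS.
under [RHS]eq_bigr do rewrite hE.
rewrite -triangular_sum => [|a b ab]; last first.
  by rewrite /h middle_ones_large ?scaler0 // (leq_trans kN).
rewrite /zeta_xy.
(* On the shuffle side A(d/dT) acts on each factor of a cut separately. *)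
transitivity (\sum_(i < (size k).+1) \sum_(a < N) \sum_(b < N)
    (C (A a) * x ^+ a * (C (A b) * y ^+ b)) *:
      (head_ones a (take i k) * tail_ones b (drop i k))).
  apply: eq_bigr => i _.
  have : (maxn (size (Z (rev (take i k)))) (size (Z (drop i k))) <= N)%N.
    by apply: leq_trans n0N; apply: leq_bigmax.
  rewrite geq_max => /andP[tN dN].
  rewrite -scalerA scalerAr scalerAl.
  rewrite -{1}weight_rev !sum_scaled // mulr_suml; apply: eq_bigr => a _.
  rewrite mulr_sumr; apply: eq_bigr => b _.
  by rewrite derivn_head_ones derivn_tail_ones !scalerA -scalerAl -scalerAr scalerA.
rewrite exchange_big; apply: eq_bigr => a _; rewrite exchange_big.
apply: eq_bigr => b _; rewrite /h -middle_onesE /ncs_mul scaler_sumr.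
by [].
Qed.

End RatXY.

Theorem theorem2p6 (R : realType) :
  Phi R Shuffle = rho_series (Phi R Harmonic).
Proof.
by apply/funext => k; rewrite /rho_series !PhiE zeta_xy_shuffle.
Qed.
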